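(* Let $r\in\mathbb{N}$, $n\in\mathbb{N}$, $\alpha\in\mathbb{N}$, let $p,q>1$ with $\frac1p+\frac1q=1$, and let $\beta>\frac{1}{\alpha}\left(\frac1p+n+r\right)$. Let $f\in C^{n}(\mathbb{R})$ with $f^{(n)}\in L_p(\mathbb{R})$, and let $\xi>0$. Then $$\|\Delta(x)\|_p\le \frac{(2\alpha)^{\frac1p}\,\Gamma(\beta)\,\Gamma\left(\frac{q\beta}{2}-\frac{1}{2\alpha}\right)^{\frac1q}\,\xi^{n}\,\tau^{\frac1p}}{\Gamma\left(\frac{q\beta}{2}\right)^{\frac1q}\,\Gamma\left(\frac{1}{2\alpha}\right)^{\frac1p}\,\Gamma\left(\beta-\frac{1}{2\alpha}\right)\,(rp+1)^{\frac1p}\,(n-1)!\,(q(n-1)+1)^{1/q}}\;\omega_r(f^{(n)},\xi)_p,$$ where $$0<\tau:=\int_0^\infty (1+u)^{rp+1}\frac{u^{np-1}}{(u^{2\alpha}+1)^{p\beta/2}}\,du-\int_0^\infty\frac{u^{np-1}}{(u^{2\alpha}+1)^{p\beta/2}}\,du<\infty.$$ Hence $\|\Delta(x)\|_p\to0$ as $\xi\to0$. If additionally $f^{(2m)}\in L_p(\mathbb{R})$ for $m=1,\dots,\lfloor n/2\rfloor$, then $\|M_{r,\xi}(f)-f\|_p\to0$ as $\xi\to0$.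
   Context: For $r\in\mathbb{N}$ and $n\in\mathbb{Z}_+$ set $\alpha_j=(-1)^{r-j}\binom{r}{j}j^{-n}$ for $j=1,\dots,r$ and $\alpha_0=1-\sum_{j=1}^r(-1)^{r-j}\binom{r}{j}j^{-n}$, so $\sum_{j=0}^r\alpha_j=1$. For $\alpha\in\mathbb{N}$, $\beta>\frac{1}{2\alpha}$, $\xi>0$, let $W=\frac{\Gamma(\beta)\alpha\xi^{2\alpha\beta-1}}{\Gamma(\frac{1}{2\alpha})\Gamma(\beta-\frac{1}{2\alpha})}$ and define the smooth Poisson-Cauchy type singular integral operator $M_{r,\xi}(f;x)=W\int_{-\infty}^{\infty}\frac{\sum_{j=0}^r\alpha_jf(x+jt)}{(t^{2\alpha}+\xi^{2\alpha})^{\beta}}dt$, $x\in\mathbb{R}$. Let $\delta_k=\sum_{j=1}^r\alpha_j j^k$ and $$\Delta(x):=M_{r,\xi}(f;x)-f(x)-\sum_{m=1}^{\lfloor n/2\rfloor}\frac{f^{(2m)}(x)\delta_{2m}}{(2m)!}\frac{\Gamma(\frac{2m+1}{2\alpha})\Gamma(\beta-\frac{2m+1}{2\alpha})}{\Gamma(\frac{1}{2\alpha})\Gamma(\beta-\frac{1}{2\alpha})}\xi^{2m}$$ (the sum is empty if $n=1$). For $g\in L_p(\mathbb{R})$, $\Delta_t^rg(x)=\sum_{j=0}^r(-1)^{r-j}\binom{r}{j}g(x+jt)$ and the $r$th $L_p$-modulus of smoothness is $\omega_r(g,h)_p=\sup_{|t|\le h}\|\Delta_t^rg(x)\|_{p,x}$,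 $h>0$. $\|\cdot\|_p$ denotes the $L_p(\mathbb{R})$ norm in the variable $x$. *)

(* Defs.v *)
From HB Require Import structures.
From mathcomp Require Import all_boot all_order all_algebra.
From mathcomp Require Import all_classical all_reals all_analysis.
Set Implicit Arguments. Unset Strict Implicit. Unset Printing Implicit Defensive.
Import Order.TTheory GRing.Theory Num.Theory.
Import numFieldNormedType.Exports.
Local Open Scope classical_set_scope.
Local Open Scope ring_scope.

Section Defs.
Variable R : realType.
Local Notation mu := (@lebesgue_measure R).

Definition Gamma (s : R) : R :=
  \int[mu]_(t in `]0%R, +oo[) (t `^ (s - 1) * expR (- t)).

Definition normp (p : R) (g : R -> R) : \bar R := 'N[mu]_(p%:E)[EFin \o g].

Definition in_Lp (p : R) (g : R -> R) : Prop :=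
  measurable_fun setT g /\ finite_norm mu p%:E g.

Definition Cn (n : nat) (f : R -> R) : Prop :=
  (forall k, (k < n)%N -> forall x, derivable (derive1n k f) x 1) /\ continuous (derive1n n f).

Definition fdiff (r : nat) (t : R) (g : R -> R) (x : R) : R :=
  \sum_(0 <= j < r.+1) (-1) ^+ (r - j) * 'C(r, j)%:R * g (x + j%:R * t).

Definition omega (r : nat) (p : R) (g : R -> R) (h : R) : \bar R :=
  ereal_sup [set normp p (fdiff r t g) | t in [set t : R | `|t| <= h]].

Definition alphaj (r n j : nat) : R :=
  if j == 0%N then 1 - \sum_(1 <= i < r.+1) (-1) ^+ (r - i) * 'C(r, i)%:R * (i%:R ^- n)
  else (-1) ^+ (r - j) * 'C(r, j)%:R * (j%:R ^- n).

Definition deltak (r n k : nat) : R :=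
  \sum_(1 <= j < r.+1) alphaj r n j * j%:R ^+ k.

Definition Wc (a : nat) (beta xi : R) : R :=
  Gamma beta * a%:R * xi `^ (2 * a%:R * beta - 1)
  / (Gamma (1 / (2 * a%:R)) * Gamma (beta - 1 / (2 * a%:R))).

Definition Mop (r n a : nat) (beta xi : R) (f : R -> R) (x : R) : R :=
  Wc a beta xi * \int[mu]_t ((\sum_(0 <= j < r.+1) alphaj r n j * f (x + j%:R * t))
                              / (t ^+ (2 * a) + xi ^+ (2 * a)) `^ beta).

Definition Deltaf (r n a : nat) (beta xi : R) (f : R -> R) (x : R) : R :=
  Mop r n a beta xi f x - f x
  - \sum_(1 <= m < (n./2).+1)
      (derive1n (2 * m) f x * deltak r n (2 * m) / (2 * m)`!%:R
       * (Gamma ((2 * m + 1)%:R / (2 * a%:R))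
          * Gamma (beta - (2 * m + 1)%:R / (2 * a%:R))
          / (Gamma (1 / (2 * a%:R)) * Gamma (beta - 1 / (2 * a%:R))))
       * xi ^+ (2 * m)).

Definition tau (r n a : nat) (p beta : R) : \bar R :=
  (\int[mu]_(u in `]0%R, +oo[)
     ((1 + u) `^ (r%:R * p + 1) * u `^ (n%:R * p - 1)
       / (u ^+ (2 * a) + 1) `^ (p * beta / 2))%:E
   - \int[mu]_(u in `]0%R, +oo[)
     (u `^ (n%:R * p - 1) / (u ^+ (2 * a) + 1) `^ (p * beta / 2))%:E)%E.

Definition Kconst (r n a : nat) (p q beta xi : R) : R :=
  (2 * a%:R) `^ (1 / p) * Gamma beta * Gamma (q * beta / 2 - 1 / (2 * a%:R)) `^ (1 / q)
  * xi ^+ n * (fine (tau r n a p beta)) `^ (1 / p)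
  / (Gamma (q * beta / 2) `^ (1 / q) * Gamma (1 / (2 * a%:R)) `^ (1 / p)
     * Gamma (beta - 1 / (2 * a%:R)) * (r%:R * p + 1) `^ (1 / p)
     * (n.-1)`!%:R * (q * (n.-1)%:R + 1) `^ (1 / q)).

End Defs.

(* Main.v *)
(* Substituting t = xi u turns M into an integral against the fixed weight
   (u^(2a) + 1)^(-beta).  As alpha_j j^n = (-1)^(r-j) binom(r,j), the n-th order
   Taylor remainder of sum_j alpha_j f(x + j t) at t = 0 is
     t^n int_0^1 (1-s)^(n-1)/(n-1)! (Delta^r_(ts) f^(n))(x) ds,
   while the odd Taylor terms integrate to 0 and the even ones are Beta integrals:
   Delta is the weighted integral of the remainder.  Two Hoelder inequalities (in s,
   and in u with the weight split into equal halves), Tonelli's theorem and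
   ||Delta^r_t g||_p <= (1 + |t|/xi)^r omega_r(g, xi)_p give the bound. *)
Require Import Defs.
From HB Require Import structures.
From mathcomp Require Import all_boot all_order all_algebra.
From mathcomp Require Import all_classical all_reals all_analysis.
From mathcomp Require Import measurable_realfun ring lra zify.
Import Order.TTheory GRing.Theory Num.Theory.
Import numFieldNormedType.Exports.
Local Open Scope classical_set_scope.
Local Open Scope ring_scope.

(** * Affine changes of variables and half-line integrals *)

Section change_of_variables.
Context {R : realType}.
Local Notation mu := (@lebesgue_measure R).

(** Every factor of the constant can be traced. The L_q norm of (1-s)^(n-1)/(n-1)! gives (n-1)! and
    q(n-1)+1. The half of the weight that forms the second Hoelder factor gives the Gamma values at
    q beta/2; the other half leaves p beta/2 in [tau]. The bound on differences enters as
    (1+|u|s)^(rp), whose integral over s in [0,1] is ((1+|u|)^(rp+1) - 1)/((rp+1)|u|): hence the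
    difference of two integrals in [tau] and its exponent np-1. The assumption on [beta] is the
    condition for the first of these integrals to converge at infinity. The obstacle is that nothing
    is assumed on the growth of f, so the integral defining M(f;x) is not known in advance to
    converge, and a divergent one takes a default value. The estimates are therefore made for p-th
    powers in the extended reals, where Tonelli's theorem asks only for nonnegative measurable
    integrands; convergence at a given x is extracted from the finiteness of the bound itself, and
    the p-th root is taken at the very end. *)

Lemma lebesgue_measure_affine (c b : R) (A : set R) : 0 < c -> measurable A ->
  (c%:E * mu ((fun x => (c * x + b)%R : measurableTypeR R) @^-1` A) = mu A)%E.
Proof.
move=> c0 mA.
have mphi : measurable_fun [set: measurableTypeR R]
    (fun x : measurableTypeR R => (c * x + b)%R : measurableTypeR R).
  by apply: measurable_funD => //; exact: measurable_funM.
pose nu : {measure set (measurableTypeR R) -> \bar R} :=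
  mscale (NngNum (ltW c0)) (pushforward mu
    (fun x : measurableTypeR R => (c * x + b)%R : measurableTypeR R)).
(* Lebesgue measure is determined by its values on half-open intervals, so the rescaled image
   measure has to be computed only there. *)
suff -> : mu A = nu mphi A by [].
apply: lebesgue_measure_unique => // _ [[x y] _ <-].
rewrite /nu /mscale/= /pushforward/=.
rewrite [X in _ = (_ * lebesgue_measure X)%E](_ : _ =
    `]((x - b) / c)%R, ((y - b) / c)%R]%classic); last first.
  apply/seteqP; split => z /=; rewrite !in_itv/= ltr_pdivrMr// ler_pdivlMr//;
  rewrite ltrBlDr lerBrDr mulrC//.
rewrite !lebesgue_measure_itv/= !lte_fin ltr_pM2r ?invr_gt0// ltrD2r.
case: ifPn => _; last by rewrite mule0.
rewrite -!EFinB -EFinM; congr EFin; field; exact: lt0r_neq0.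
Qed.

Lemma ge0_integral_affine (c b : R) (f : R -> \bar R) : 0 < c ->
  measurable_fun setT f -> (forall x, 0 <= f x)%E ->
  (c%:E * \int[mu]_x f (c * x + b)%R = \int[mu]_x f x)%E.
Proof.
move=> c0 mf f0.
have mphi : measurable_fun [set: measurableTypeR R]
    (fun x : measurableTypeR R => (c * x + b)%R : measurableTypeR R).
  by apply: measurable_funD => //; exact: measurable_funM.
pose nu : {measure set (measurableTypeR R) -> \bar R} :=
  mscale (NngNum (ltW c0)) (pushforward mu
    (fun x : measurableTypeR R => (c * x + b)%R : measurableTypeR R)).
transitivity (\int[nu mphi]_x f x)%E; last first.
  apply: eq_measure_integral => A mA _.
  exact: lebesgue_measure_affine.
by rewrite ge0_integral_mscale//= ge0_integral_pushforward// preimage_setT.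
Qed.

Lemma ge0_integral_oppr (f : R -> \bar R) :
  measurable_fun setT f -> (forall x, 0 <= f x)%E ->
  (\int[mu]_x f (- x)%R = \int[mu]_x f x)%E.
Proof.
move=> mf f0.
rewrite -[LHS](@ge0_integral_pushforward _ _ _ (measurableTypeR R) _ _ _ mu setT)//.
by apply: eq_measure_integral => A mA _; exact: lebesgue_measureN.
Qed.

(** Positive and negative parts scale separately, and the infinite values are checked case by case.
    No integrability is assumed, so the substitution may precede any proof of convergence. *)
Lemma integral_affine (c b : R) (f : R -> \bar R) : 0 < c ->
  measurable_fun setT f ->
  (\int[mu]_x f (c * x + b)%R = c^-1%:E * \int[mu]_x f x)%E.
Proof.
move=> c0 mf; rewrite integralE [in RHS]integralE.
rewrite -(ge0_integral_affine c b f^\+%E) //; last exact: measurable_funepos.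
rewrite -(ge0_integral_affine c b f^\-%E) //; last exact: measurable_funeneg.
transitivity (\int[mu]_x f^\+ (c * x + b)%R - \int[mu]_x f^\- (c * x + b)%R)%E.
  by congr (_ - _)%E; apply: eq_integral => x _; rewrite ?funeposE ?funenegE.
have : (0 <= \int[mu]_x f^\+ (c * x + b)%R)%E by exact: integral_ge0.
have : (0 <= \int[mu]_x f^\- (c * x + b)%R)%E by exact: integral_ge0.
have ci : 0 < c^-1 by rewrite invr_gt0.
move: (\int[mu]_x f^\- _)%E (\int[mu]_x f^\+ _)%E => [y||] [x||]// _ _.
 - by rewrite -!(EFinM, EFinB); congr EFin; field; exact: lt0r_neq0.
- by rewrite mulry gtr0_sg// mul1e /= mulry gtr0_sg// mul1e.
- by rewrite mulry gtr0_sg// mul1e /= mulrNy gtr0_sg// mul1e.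
- by rewrite mulry gtr0_sg// mul1e /= mulrNy gtr0_sg// mul1e.
Qed.

Lemma integral_oppr (f : R -> \bar R) : measurable_fun setT f ->
  (\int[mu]_x f (- x)%R = \int[mu]_x f x)%E.
Proof.
move=> mf; rewrite integralE [in RHS]integralE.
rewrite -(ge0_integral_oppr f^\+%E) //; last exact: measurable_funepos.
rewrite -(ge0_integral_oppr f^\-%E) //; last exact: measurable_funeneg.
by congr (_ - _)%E; apply: eq_integral => x _; rewrite ?funeposE ?funenegE.
Qed.

Lemma integral_odd (f : R -> \bar R) : measurable_fun setT f ->
  (forall x, f (- x)%R = - f x)%E -> mu.-integrable setT f ->
  (\int[mu]_x f x = 0)%E.
Proof.
move=> mf fodd fi.
have : (\int[mu]_x f x \is a fin_num)%E by exact: integrable_fin_num.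
have : (\int[mu]_x f x = - \int[mu]_x f x)%E.
  rewrite -[LHS](integral_oppr f)//; under eq_integral do rewrite fodd.
  by rewrite integralN//; exact: integrable_add_def.
case: (\int[mu]_x f x)%E => // r [] rr _; congr EFin; lra.
Qed.

Lemma ge0_integral_even (f : R -> \bar R) : measurable_fun setT f ->
  (forall x, 0 <= f x)%E -> (forall x, f (- x)%R = f x)%E ->
  (\int[mu]_x f x = 2%:E * \int[mu]_(x in `]0%R, +oo[) f x)%E.
Proof.
move=> mf f0 fev.
have mfS (D : set R) : measurable_fun D f by exact: measurable_funTS.
rewrite -(setUv `]0%R, +oo[) ge0_integral_setU//=; last first.
  exact/disj_setPCl.
  exact: mfS.
  exact: measurableC.
(* The complement is the closed half-line up to 0; dropping the null point 0 makes the two halves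
   mirror images. *)
rewrite setCitvr -(integral_itv_bndo_bndc)//.
rewrite mule_natl mule2n; congr (_ + _)%E.
rewrite integral_mkcond [RHS]integral_mkcond -[LHS]ge0_integral_oppr//=.
- apply: eq_integral => x _; rewrite !patchE !mem_setE !in_itv/= andbT oppr_lt0.
  by rewrite fev.
- by apply/(measurable_restrictT f) => //.
- by move=> x; rewrite patchE; case: ifP.
Qed.

Lemma ge0_integral_Ioi_scale (c : R) (f : R -> \bar R) : 0 < c ->
  measurable_fun setT f -> (forall x, 0 <= f x)%E ->
  (\int[mu]_(x in `]0%R, +oo[) f (c * x)%R
   = c^-1%:E * \int[mu]_(x in `]0%R, +oo[) f x)%E.
Proof.
move=> c0 mf f0; rewrite integral_mkcond [in RHS]integral_mkcond.
rewrite -(integral_affine c 0)//; last first.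
  by apply/(measurable_restrictT f) => //; exact: measurable_funTS.
apply: eq_integral => x _; rewrite !patchE addr0 !mem_setE !in_itv/= !andbT.
by rewrite pmulr_rgt0.
Qed.

End change_of_variables.

(** * Tonelli's theorem on measurable rectangles *)

Section Tonelli.
Context {d1 d2} {T1 : measurableType d1} {T2 : measurableType d2} {R : realType}.
Context (m1 : {sigma_finite_measure set T1 -> \bar R})
        (m2 : {sigma_finite_measure set T2 -> \bar R}).

Lemma fubini_tonelliD (A : set T1) (B : set T2) (f : T1 * T2 -> \bar R) :
  measurable A -> measurable B -> measurable_fun setT f ->
  (forall z, 0 <= f z)%E ->
  (\int[m1]_(x in A) \int[m2]_(y in B) f (x, y) =
   \int[m2]_(y in B) \int[m1]_(x in A) f (x, y))%E.
Proof.
move=> mA mB mf f0.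
have mAB : measurable (A `*` B) by exact: measurableX.
have -> : (\int[m1]_(x in A) \int[m2]_(y in B) f (x, y) =
    \int[m1]_x \int[m2]_y (f \_ (A `*` B)) (x, y))%E.
  rewrite integral_mkcond; apply: eq_integral => x _; rewrite patchE.
  case: ifPn => xA.
    rewrite integral_mkcond; apply: eq_integral => y _; rewrite !patchE.
    by rewrite in_setX/= xA.
  by rewrite integral0_eq// => y _; rewrite patchE in_setX/= (negbTE xA).
have -> : (\int[m2]_(y in B) \int[m1]_(x in A) f (x, y) =
    \int[m2]_y \int[m1]_x (f \_ (A `*` B)) (x, y))%E.
  rewrite integral_mkcond; apply: eq_integral => y _; rewrite patchE.
  case: ifPn => yB.
    rewrite integral_mkcond; apply: eq_integral => x _; rewrite !patchE.
    by rewrite in_setX/= yB andbT.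
  by rewrite integral0_eq// => x _; rewrite patchE in_setX/= (negbTE yB) andbF.
apply: fubini_tonelli.
  by apply/(measurable_restrictT f) => //; exact: measurable_funTS.
by move=> z; rewrite patchE; case: ifP.
Qed.

Lemma measurable_fun_integralD (B : set T2) (f : T1 * T2 -> \bar R) :
  measurable B -> measurable_fun setT f -> (forall z, 0 <= f z)%E ->
  measurable_fun setT (fun x => \int[m2]_(y in B) f (x, y))%E.
Proof.
move=> mB mf f0.
rewrite (_ : (fun x => _) = (fubini_F m2 (f \_ (setT `*` B)))); last first.
  apply/funext => x; rewrite /fubini_F [LHS]integral_mkcond.
  apply: eq_integral => y _; rewrite !patchE.
  by rewrite in_setX/= in_setT.
apply: measurable_fun_fubini_tonelli_F.
  apply/(measurable_restrictT f); first exact: measurableX.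
  exact: measurable_funTS.
by move=> z; rewrite patchE; case: ifP.
Qed.

End Tonelli.

(** * Strict positivity of integrals *)

Section positive_integral.
Context {d} {T : measurableType d} {R : realType}.
Context (m : {measure set T -> \bar R}).

(** If the integral vanished, [f] would vanish almost everywhere on [D], and [D] would be contained
    in a null set. *)
Lemma integral_gt0 (D : set T) (f : T -> R) : measurable D ->
  measurable_fun D f -> (0 < m D)%E -> (forall x, D x -> 0 < f x) ->
  (0 < \int[m]_(x in D) (f x)%:E)%E.
Proof.
move=> mD mf mD0 f0; rewrite lt_neqAle integral_ge0 ?andbT; last first.
  by move=> x Dx; rewrite lee_fin ltW// f0.
apply/negP => /eqP I0.
have mfE : measurable_fun D (EFin \o f) by exact/measurable_EFinP.
have : (\int[m]_(x in D) `|(EFin \o f) x| = 0)%E.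
  rewrite I0; apply: eq_integral => x /[!inE] Dx.
  by rewrite /= ger0_norm// ltW// f0.
move/(ae_eq_integral_abs m mD mfE) => [N [mN N0 DN]].
suff : (m D <= m N)%E by rewrite N0 leNgt mD0.
apply: le_measure; rewrite ?inE// => x Dx; apply: DN => /= /(_ Dx) [fx0].
by have := f0 x Dx; rewrite fx0 ltxx.
Qed.

End positive_integral.

(** The inverse is the power with exponent -1 on nonnegative reals, zero included: both conventions
    send 0 to 0. *)
Lemma ge0_measurable_funV {d} {T : measurableType d} {R : realType} (D : set T)
    (f : T -> R) : (forall x, 0 <= f x) ->
  measurable_fun D f -> measurable_fun D (fun x => (f x)^-1).
Proof.
move=> f0 mf; rewrite (_ : (fun _ => _) = fun x => f x `^ (-1)).
  exact: (measurableT_comp (measurable_powR _)).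
by apply/funext => x; rewrite powR_inv1.
Qed.

(** * Exhaustion of the half-line and the substitution x^m *)

Section half_line.
Context {R : realType}.
Local Notation mu := (@lebesgue_measure R).

(** The fundamental theorem of calculus and the substitution rule are applied on compact intervals;
    monotone convergence carries them to the half-line. The intervals avoid 0, where powers with
    negative exponent are singular. *)
Lemma ge0_cvg_integral_Ioi (a b : nat -> R) (f : R -> \bar R) :
  {homo a : m n / (m <= n)%N >-> n <= m} -> {homo b : m n / (m <= n)%N >-> m <= n} ->
  (forall n, 0 < a n) -> (forall x, 0 < x -> exists n, a n <= x <= b n) ->
  measurable_fun (`]0%R, +oo[%classic : set R) f -> (forall x : R, 0 < x -> (0 <= f x)%E) ->
  (\int[mu]_(x in `[a n, b n]) f x)%E @[n --> \oo] -->
  (\int[mu]_(x in `]0%R, +oo[) f x)%E.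
Proof.
move=> ha hb a0 ab mf f0.
have -> : `]0%R, +oo[%classic = \bigcup_n `[a n, b n]%classic.
  apply/seteqP; split => [x /=|x [n _]/=]; rewrite in_itv/=.
    by rewrite andbT => /ab[n xn]; exists n => //=; rewrite in_itv.
  by move=> /andP[ax _]; rewrite in_itv/= andbT (lt_le_trans (a0 n)).
apply: ge0_nondecreasing_set_cvg_integral.
- move=> m n mn; rewrite subsetEset => x /=; rewrite !in_itv/= => /andP[ax xb].
  by rewrite (le_trans (ha _ _ mn))//= (le_trans xb)// hb.
- by move=> i; exact: measurable_itv.
- move=> i; apply: measurable_funS mf => // x /=; rewrite !in_itv/= => /andP[ax _].
  by rewrite andbT (lt_le_trans (a0 i)).
- by move=> i x /=; rewrite in_itv/= => /andP[ax _]; rewrite f0// (lt_le_trans (a0 i)).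
Qed.

Let invS_homo : {homo (fun n : nat => n.+1%:R^-1 : R) : m n / (m <= n)%N >-> n <= m}.
Proof. by move=> m n mn; rewrite lef_pV2 ?posrE ?ltr0n// ler_nat ltnS. Qed.

Let natS_homo : {homo (fun n : nat => n.+1%:R : R) : m n / (m <= n)%N >-> m <= n}.
Proof. by move=> m n mn; rewrite ler_nat ltnS. Qed.

Let invS_natS (x : R) : 0 < x -> exists n : nat, n.+1%:R^-1 <= x <= n.+1%:R.
Proof.
move=> x0; exists (maxn (Num.truncn x) (Num.truncn x^-1)).
apply/andP; split.
  rewrite -[leRHS]invrK lef_pV2 ?posrE ?invr_gt0 ?ltr0n//.
  by rewrite (le_trans (ltW (truncnS_gt _)))// ler_nat ltnS leq_maxr.
by rewrite (le_trans (ltW (truncnS_gt _)))// ler_nat ltnS leq_maxl.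
Qed.

Lemma ge0_integral_Ioi_le (f : R -> \bar R) (M : \bar R) :
  measurable_fun (`]0%R, +oo[%classic : set R) f -> (forall x : R, 0 < x -> (0 <= f x)%E) ->
  (forall a b : R, 0 < a -> a < b -> (\int[mu]_(x in `[a, b]) f x <= M)%E) ->
  (\int[mu]_(x in `]0%R, +oo[) f x <= M)%E.
Proof.
move=> mf f0 fM.
have cf := ge0_cvg_integral_Ioi _ _ f invS_homo natS_homo
  (fun n => etrans (invr_gt0 _) (ltr0Sn R n)) invS_natS mf f0.
rewrite -(cvg_lim _ cf)//; apply: lime_le; first by apply/cvg_ex; eexists; exact: cf.
(* Index 0 gives the single point 1, which the hypothesis on [a < b] does not cover. Its integral is
   0, and [M] is nonnegative because it bounds the integral over [1, 2]. *)
apply: nearW => n; case: n => [|n]; last first.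
  apply: fM; first by rewrite invr_gt0 ltr0n.
  by rewrite (@lt_trans _ _ 1) ?invf_lt1 ?ltr1n ?ltr0n.
rewrite invr1 set_itv1 integral_set1.
by apply: le_trans (fM 1 2 _ _); rewrite ?ltr1n//; apply: integral_ge0 => x /=;
  rewrite in_itv/= => /andP[x1 _]; rewrite f0// (lt_le_trans ltr01).
Qed.

Lemma is_derive_exprn (m : nat) (x : R) :
  is_derive x 1 (fun y : R => y ^+ m) (m%:R * x ^+ m.-1).
Proof.
have := is_deriveX m (is_derive_id x 1).
rewrite /GRing.scale/= mulr1 (_ : id ^+ m = fun y : R => y ^+ m)//.
by apply/funext => y; rewrite exprfctE.
Qed.

(** The images of the exhausting intervals under x^m exhaust the half-line as well, so both sides
    are limits of one and the same sequence of integrals. *)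
Lemma ge0_integral_Ioi_exprn (m : nat) (G : R -> R) : (0 < m)%N ->
  (forall x, 0 < x -> {for x, continuous G}) -> (forall x, 0 < x -> 0 <= G x) ->
  measurable_fun setT G ->
  (\int[mu]_(x in `]0%R, +oo[) (G x)%:E =
   \int[mu]_(x in `]0%R, +oo[) (G (x ^+ m) * (m%:R * x ^+ m.-1))%:E)%E.
Proof.
move=> m0 cG G0 mG.
have dF : (fun y : R => y ^+ m)^`()%classic = fun x => m%:R * x ^+ m.-1.
  by apply/funext => x; rewrite derive1E; have [_ ->] := is_derive_exprn m x.
have cF' : continuous (fun x : R => m%:R * x ^+ m.-1).
  by move=> x; apply: cvgM; [exact: cvg_cst|exact: exprn_continuous].
pose a n : R := n.+1%:R^-1; pose b n : R := n.+1%:R.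
have a0 n : 0 < a n by rewrite invr_gt0 ltr0n.
have ab n : a n <= b n.
  by rewrite (@le_trans _ _ 1)// ?invf_le1 ?ler1n ?ltr0n.
have b0 n : 0 < b n by rewrite (lt_le_trans (a0 n)).
have mono (x y : R) : 0 <= x -> x <= y -> x ^+ m <= y ^+ m.
  by move=> x0 xy; rewrite lerXn2r ?nnegrE// (le_trans x0).
have e n : (\int[mu]_(x in `[(a n ^+ m)%R, (b n ^+ m)%R]) (G x)%:E =
    \int[mu]_(x in `[a n, b n]) (G (x ^+ m) * (m%:R * x ^+ m.-1))%:E)%E.
  have itvpos (x : R) : x \in `[a n, b n] -> 0 < x.
    by rewrite in_itv/= => /andP[ax _]; rewrite (lt_le_trans (a0 n)).
  rewrite (@integration_by_substitution_increasing _ (fun y => y ^+ m))//.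
  - by apply: eq_integral => x _; rewrite dF.
  - move=> x y xab yab xy; by rewrite ltrXn2r -?lt0n ?(ltW (itvpos _ xab)).
  - by rewrite dF => x _; exact: cF'.
  - by rewrite dF; apply/cvg_ex; eexists; apply: cvg_at_right_filter; exact: cF'.
  - by rewrite dF; apply/cvg_ex; eexists; apply: cvg_at_left_filter; exact: cF'.
  - split.
    + by move=> x _; have [] := is_derive_exprn m x.
    + by apply: cvg_at_right_filter; exact: exprn_continuous.
    + by apply: cvg_at_left_filter; exact: exprn_continuous.
  - apply: continuous_in_subspaceT => x; rewrite inE/= in_itv/= => /andP[ax _].
    by apply: cG; rewrite (lt_le_trans _ ax)// exprn_gt0.
have c1 : (\int[mu]_(x in `[(a n ^+ m)%R, (b n ^+ m)%R]) (G x)%:E @[n --> \oo] -->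
    \int[mu]_(x in `]0%R, +oo[) (G x)%:E)%E.
  apply: (ge0_cvg_integral_Ioi (fun n => a n ^+ m) (fun n => b n ^+ m)).
  - by move=> k l kl; apply: mono (invS_homo _ _ kl); exact: ltW.
  - by move=> k l kl; apply: mono (natS_homo _ _ kl); exact: ltW.
  - by move=> k; exact: exprn_gt0.
  - move=> x x0; have [k /andP[k1 k2]] := invS_natS x x0; exists k; apply/andP; split.
      by rewrite (le_trans _ k1)// ler_iXnr// ?invf_le1 ?ler1n ?ltr0n// ltW.
    by rewrite (le_trans k2)// ler_eXnr// ler1n.
  - by apply/measurable_EFinP; exact: measurable_funTS.
  - by move=> x x0; rewrite lee_fin G0.
have c2 : (\int[mu]_(x in `[a n, b n]) (G (x ^+ m) * (m%:R * x ^+ m.-1))%:E @[n --> \oo] -->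
    \int[mu]_(x in `]0%R, +oo[) (G (x ^+ m) * (m%:R * x ^+ m.-1))%:E)%E.
  apply: (ge0_cvg_integral_Ioi a b) => //.
  - apply/measurable_EFinP; apply: measurable_funTS; apply: measurable_funM.
      by apply: (measurableT_comp mG); exact: exprn_measurable.
    by apply: measurable_funM => //; exact: measurable_funX.
  - move=> x x0; rewrite lee_fin mulr_ge0 ?G0 ?exprn_gt0//.
    by rewrite mulr_ge0// exprn_ge0// ltW.
rewrite -(cvg_lim _ c1)// -(cvg_lim _ c2)//.
by under eq_fun do rewrite e.
Qed.

End half_line.

(** * The modulus of smoothness *)

Section Lp_seminorm.
Context {R : realType}.
Local Notation mu := (@lebesgue_measure R).
Implicit Types (p h t : R) (u v g : R -> R).

Lemma normpE p g : normp p g = ((\int[mu]_x (`|g x| `^ p)%:E) `^ p^-1)%E.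
Proof. by rewrite /normp unlock. Qed.

Lemma normp_ge0 p g : (0 <= normp p g)%E.
Proof. exact: Lnorm_ge0. Qed.

Lemma normp_powR p g : p != 0 ->
  (normp p g `^ p = \int[mu]_x (`|g x| `^ p)%:E)%E.
Proof. exact: poweR_Lnorm. Qed.

Lemma eq_normp p u v : u =1 v -> normp p u = normp p v.
Proof. by move=> /funext ->. Qed.

Lemma measurable_normr_powR d (T : measurableType d) p (D : set T) (u : T -> R) :
  measurable_fun D u -> measurable_fun D (fun x => (`|u x| `^ p)%:E).
Proof.
move=> mU; apply/measurable_EFinP.
apply: (measurableT_comp (measurable_powR p)).
exact: measurableT_comp.
Qed.

Lemma normp_shift p g h : measurable_fun setT g ->
  normp p (fun x => g (x + h)) = normp p g.
Proof.
move=> mg; rewrite (normpE p g) normpE.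
have -> // : (\int[mu]_x (`|g (x + h)| `^ p)%:E = \int[mu]_x (`|g x| `^ p)%:E)%E.
rewrite -(ge0_integral_affine 1 h (fun x => (`|g x| `^ p)%:E))//.
  by rewrite mul1e; apply: eq_integral => x _; rewrite mul1r.
exact: measurable_normr_powR.
Qed.

Lemma normpZ p (c : R) g : 0 < p -> measurable_fun setT g ->
  normp p (fun x => c * g x) = (`|c|%:E * normp p g)%E.
Proof.
move=> p0 mg; rewrite 2!normpE.
under eq_integral do rewrite normrM powRM// EFinM.
rewrite ge0_integralZl//=; last exact: measurable_normr_powR.
rewrite poweRM ?lee_fin ?powR_ge0//; last first.
  by apply: integral_ge0 => x _; rewrite lee_fin powR_ge0.
by rewrite poweR_EFin -powRrM mulfV ?gt_eqF// powRr1.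
Qed.

Lemma ler_normpD p u v : 1 <= p -> measurable_fun setT u ->
  measurable_fun setT v ->
  (normp p (fun x => u x + v x)%R <= normp p u + normp p v)%E.
Proof. by move=> p1 mU mv; exact: minkowski_EFin. Qed.

Lemma ler_normp_sum p (I : Type) (s : seq I) (u : I -> R -> R) : 1 <= p ->
  (forall i, measurable_fun setT (u i)) ->
  (normp p (fun x => \sum_(i <- s) u i x)%R <= \sum_(i <- s) normp p (u i))%E.
Proof.
move=> p1 mU; elim: s => [|i s ih].
  rewrite big_nil (@eq_normp _ _ (cst 0)); last by move=> x; rewrite big_nil.
  by rewrite /normp Lnorm0// eqe gt_eqF// (lt_le_trans _ p1).
rewrite big_cons (@eq_normp _ _ (fun x => u i x + \sum_(j <- s) u j x)).
  apply: (le_trans (ler_normpD p _ _ p1 (mU i) _)).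
    by apply: measurable_sum.
  by rewrite leeD2l.
by move=> x; rewrite big_cons.
Qed.

End Lp_seminorm.

Section modulus_of_smoothness.
Context {R : realType}.
Implicit Types (p h t x : R) (u g : R -> R) (r m : nat).

Definition diff1 t u x := u (x + t) - u x.

Definition shiftsum m h u x := \sum_(0 <= i < m) u (x + i%:R * h).

(** Binomial expansion of (X - 1)^r, where X is the shift by [t]; Pascal's rule is the induction
    step. In operator form, polynomial identities in X become identities between differences. *)
Lemma fdiff_iter r t g x : fdiff r t g x = iter r (diff1 t) g x.
Proof.
elim: r x => [|r ih] x.
  by rewrite /fdiff big_nat1 /= subnn expr0 bin0 !mul1r mul0r addr0.
rewrite iterS {1}/diff1 -!ih.
transitivity ((-1) ^+ r.+1 * g x +
   \sum_(0 <= j < r.+1) (-1) ^+ (r - j) * 'C(r.+1, j.+1)%:R * g (x + j.+1%:R * t)).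
  by rewrite /fdiff big_nat_recl// subn0 bin0 mulr1 mul0r addr0.
have -> : fdiff r t g (x + t) =
    \sum_(0 <= j < r.+1) (-1) ^+ (r - j) * 'C(r, j)%:R * g (x + j.+1%:R * t).
  apply: eq_bigr => j _; congr (_ * g _).
  by rewrite -addrA -[in RHS]natr1 mulrDl mul1r [t + _]addrC.
have -> : fdiff r t g x = (-1) ^+ r * g x -
    \sum_(0 <= j < r.+1) (-1) ^+ (r - j) * 'C(r, j.+1)%:R * g (x + j.+1%:R * t).
  rewrite /fdiff big_nat_recl// subn0 bin0 mulr1 mul0r addr0; congr (_ + _).
  (* The sum on the right has one more term, at index [r]; its coefficient binom(r, r+1) is 0. *)
  rewrite big_nat_recr//= bin_small// mulr0 mul0r addr0 -sumrN.
  apply: eq_big_nat => j /andP[_ jr]; rewrite -!mulNr; congr (_ * _ * _).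
  by rewrite -(subnSK jr) exprS mulN1r opprK.
rewrite opprB addrA -big_split/= exprS mulN1r mulNr [LHS]addrC; congr (_ - _).
apply: eq_bigr => j _; rewrite binS natrD; ring.
Qed.

Lemma measurable_shift u h : measurable_fun setT u ->
  measurable_fun setT (fun x => u (x + h)).
Proof.
by move=> mU; apply: (measurableT_comp mU); exact: measurable_funD.
Qed.

Lemma measurable_diff1 t u : measurable_fun setT u ->
  measurable_fun setT (diff1 t u).
Proof. by move=> mU; apply: measurable_funB => //; exact: measurable_shift. Qed.

Lemma measurable_iter_diff1 r t u : measurable_fun setT u ->
  measurable_fun setT (iter r (diff1 t) u).
Proof. by move=> mU; elim: r => //= r; exact: measurable_diff1. Qed.

Lemma measurable_shiftsum m h u : measurable_fun setT u ->
  measurable_fun setT (shiftsum m h u).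
Proof. by move=> mU; apply: measurable_sum => i; exact: measurable_shift. Qed.

Lemma diff1_mulrn m h u :
  diff1 (m%:R * h) u = shiftsum m h (diff1 h u).
Proof.
apply/funext => x; rewrite /diff1 /shiftsum.
transitivity (\sum_(0 <= i < m) (u (x + i.+1%:R * h) - u (x + i%:R * h))).
  by rewrite telescope_sumr// mul0r addr0.
apply: eq_bigr => i _; congr (u _ - _).
by rewrite -natr1 mulrDl mul1r addrA.
Qed.

Lemma diff1_shiftsum m h u :
  diff1 h (shiftsum m h u) = shiftsum m h (diff1 h u).
Proof.
apply/funext => x; rewrite /diff1 /shiftsum -sumrB.
by apply: eq_bigr => i _; rewrite addrAC.
Qed.

(* [X^m - 1 = (1 + ... + X^(m-1)) (X - 1)] for the shift [X] by [h]. *)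
Lemma iter_diff1_mulrn r m h u :
  iter r (diff1 (m%:R * h)) u = iter r (shiftsum m h) (iter r (diff1 h) u).
Proof.
elim: r => // r ih; rewrite iterS ih diff1_mulrn iterS; congr shiftsum.
rewrite [in RHS]iterS; elim: r {ih} (iter r _ u) => // k ih v.
by rewrite iterS diff1_shiftsum ih.
Qed.

(** Shifts preserve the L_p norm, so a sum of [m] of them has operator norm at most [m]. *)
Lemma normp_iter_shiftsum p r m h u : 1 <= p -> measurable_fun setT u ->
  (normp p (iter r (shiftsum m h) u) <= (m%:R ^+ r)%:E * normp p u)%E.
Proof.
move=> p1 mU; elim: r => [|r ih]; first by rewrite expr0 mul1e.
rewrite iterS; set v := iter r _ u in ih *.
have mv : measurable_fun setT v.
  by rewrite /v; elim: (r) => //= k; exact: measurable_shiftsum.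
apply: (@le_trans _ _ (m%:R%:E * normp p v)%E).
  apply: (le_trans (ler_normp_sum p _ _ (fun i x => v (x + i%:R * h)) p1 _)).
    by move=> i; exact: measurable_shift.
  under eq_bigr do rewrite normp_shift//.
  rewrite (_ : (\sum_(0 <= i < m) normp p v = m%:R%:E * normp p v)%E)//.
  elim: (m) => [|k ihk]; first by rewrite big_nil mul0e.
  rewrite big_nat_recr//= ihk -natr1 EFinD ge0_muleDl ?lee_fin//.
  by rewrite mul1e.
by rewrite exprS EFinM -muleA lee_wpmul2l// lee_fin.
Qed.

(** The step [t] is cut into m = floor(|t|/h) + 1 equal steps of length at most [h]. The
    factorization of the difference then costs m^r, and m is at most 1 + |t|/h. *)
Lemma normp_fdiff_omega p r t h g : 1 <= p -> 0 < h -> measurable_fun setT g ->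
  (normp p (fdiff r t g) <= ((1 + `|t| / h) ^+ r)%:E * omega r p g h)%E.
Proof.
move=> p1 h0 mg.
pose m := (Num.truncn (`|t| / h)).+1; pose t' := t / m%:R.
have th0 : 0 <= `|t| / h by rewrite divr_ge0// ltW.
have m0 : 0 < m%:R :> R by rewrite ltr0n.
have tE : t = m%:R * t' by rewrite /t' mulrC divfK// gt_eqF.
have t'h : `|t'| <= h.
  rewrite /t' normrM normfV (ger0_norm (ltW m0)) ler_pdivrMr// mulrC -ler_pdivrMr//.
  by rewrite ltW// truncnS_gt.
rewrite (eq_normp _ _ (iter r (diff1 t) g)); last by move=> x; exact: fdiff_iter.
rewrite tE iter_diff1_mulrn.
apply: (le_trans (normp_iter_shiftsum _ _ _ _ _ p1 (measurable_iter_diff1 _ _ _ mg))).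
apply: lee_pmul.
- by rewrite lee_fin exprn_ge0.
- exact: normp_ge0.
- rewrite lee_fin -tE lerXn2r ?nnegrE ?addr_ge0//.
  by rewrite /m -natr1 addrC lerD2l truncn_le.
- apply: ereal_sup_ubound; exists t' => //=.
  by apply: eq_normp => x; exact: fdiff_iter.
Qed.

Lemma omega_ge0 p r h g : 0 <= h -> (0 <= omega r p g h)%E.
Proof.
move=> h0; apply: (@le_trans _ _ (normp p (fdiff r 0 g))).
  exact: normp_ge0.
by apply: ereal_sup_ubound; exists 0 => //=; rewrite normr0.
Qed.

(** The bound is uniform in [h]. This suffices for the limits as [xi] tends to 0: the decay comes
    from the power of [xi] in the constant, not from the modulus. *)
Lemma omega_bounded p r g : 1 <= p -> in_Lp p g ->
  exists2 M : R, 0 <= M & forall h, (omega r p g h <= M%:E)%E.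
Proof.
move=> p1 [mg fing].
have nfin : normp p g \is a fin_num by rewrite ge0_fin_numE ?normp_ge0.
exists (\sum_(0 <= j < r.+1) `|(-1) ^+ (r - j) * 'C(r, j)%:R| * fine (normp p g)).
  by apply: sumr_ge0 => i _; rewrite mulr_ge0// fine_ge0// normp_ge0.
move=> h; apply: ge_ereal_sup => _ [t _ <-].
apply: (le_trans (ler_normp_sum p _ _
  (fun j x => (-1) ^+ (r - j) * 'C(r, j)%:R * g (x + j%:R * t)) p1 _)).
  by move=> i; apply: measurable_funM => //; exact: measurable_shift.
rewrite -sumEFin; apply: lee_sum => i _.
rewrite normpZ ?(lt_le_trans _ p1)//; last exact: measurable_shift.
by rewrite normp_shift// EFinM fineK.
Qed.

End modulus_of_smoothness.

(** * Taylor remainders *)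

Section power_integrals.
Context {R : realType}.
Local Notation mu := (@lebesgue_measure R).

Lemma continuous_powR_gt0 (e x : R) : 0 < x ->
  {for x, continuous (fun x : R => x `^ e)}.
Proof.
move=> x0; apply: differentiable_continuous; apply/derivable1_diffP.
by apply: derivable_powR; rewrite in_itv/= x0.
Qed.

Lemma within_continuous_powR (e : R) : 0 <= e ->
  {within `[0, 1], continuous (fun x : R => x `^ e)}.
Proof.
(* Exponent 0 is treated apart because of the value at the endpoint: 0^0 is 1, whereas 0^e is 0 for
   e > 0. *)
rewrite le_eqVlt => /predU1P[<-|e0].
  have -> : (fun x : R => x `^ 0) = cst 1 by apply/funext => x; rewrite powRr0.
  by apply: continuous_subspaceT => x; exact: cvg_cst.
apply/continuous_within_itvP => //; split.
- by move=> x; rewrite in_itv/= => /andP[x0 _]; exact: continuous_powR_gt0.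
- by rewrite powR0 ?gt_eqF//; exact: powR_cvg0.
- by apply: cvg_at_left_filter; exact: continuous_powR_gt0.
Qed.

Lemma integral_powR01 (e : R) : 0 <= e ->
  (\int[mu]_(x in `[0%R, 1%R]) (x `^ e)%:E = ((e + 1)^-1)%:E)%E.
Proof.
move=> e0; have e1 : 0 < e + 1 by rewrite ltr_wpDl.
rewrite (@continuous_FTC2 _ _ (fun x => (e + 1)^-1 * x `^ (e + 1)))//.
- rewrite powR1 powR0 ?gt_eqF// mulr0 mulr1 -EFinB; congr EFin; lra.
- exact: within_continuous_powR.
- split.
  + move=> x; rewrite in_itv/= => /andP[x0 _].
    by apply: derivableM => //; apply: derivable_powR; rewrite in_itv/= x0.
  + rewrite powR0 ?gt_eqF// mulr0 -[X in _ --> X](mulr0 (e + 1)^-1).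
    by apply: cvgM; [exact: cvg_cst|exact: powR_cvg0].
  + apply: cvg_at_left_filter; apply: cvgM; first exact: cvg_cst.
    exact: continuous_powR_gt0.
- move=> x; rewrite in_itv/= => /andP[x0 _].
  rewrite derive1E deriveZ/=; last by apply: derivable_powR; rewrite in_itv/= x0.
  rewrite -derive1E powR_derive1 ?in_itv/= ?x0//.
  by rewrite addrK /GRing.scale/= mulKf// gt_eqF.
Qed.

Lemma integral_onem_powR01 (e : R) : 0 <= e ->
  (\int[mu]_(x in `[0%R, 1%R]) ((1 - x) `^ e)%:E = ((e + 1)^-1)%:E)%E.
Proof.
move=> e0; rewrite -(integral_powR01 e e0).
rewrite (@integration_by_substitution_onem _ (fun x => x `^ e)) ?ler01 ?lexx//.
  by rewrite /unstable.onem subrr.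
exact: within_continuous_powR.
Qed.

Lemma integral_1Dmul_powR01 (e u : R) : 0 <= e -> 0 < u ->
  (\int[mu]_(x in `[0%R, 1%R]) ((1 + u * x) `^ e)%:E =
   (((1 + u) `^ (e + 1) - 1) / ((e + 1) * u))%:E)%E.
Proof.
move=> e0 u0; have e1 : 0 < e + 1 by rewrite ltr_wpDl.
have pos (x : R) : 0 <= x -> 0 < 1 + u * x.
  by move=> x0; rewrite ltr_wpDr ?mulr_ge0// ltW.
have dF a (x : R) : 0 <= x ->
    is_derive x 1 (fun x => (1 + u * x) `^ a) (a * (1 + u * x) `^ (a - 1) * u).
  move=> x0.
  apply: (@is_derive1_comp _ (fun y => y `^ a) (fun x => 1 + u * x)).
    exact/is_derive1_powR/pos.
  by apply: is_derive_eq; rewrite /GRing.scale/=; ring.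
have cF a (x : R) : 0 <= x -> {for x, continuous (fun x => (1 + u * x) `^ a)}.
  move=> x0; apply: differentiable_continuous; apply/derivable1_diffP.
  by have [] := dF a x x0.
rewrite (@continuous_FTC2 _ _
    (fun x => ((e + 1) * u)^-1 * (1 + u * x) `^ (e + 1)))//.
- rewrite mulr0 addr0 mulr1 powR1 -EFinB; congr EFin.
  by rewrite mulrC [in RHS]mulrC mulrBr mulr1 [X in X - _]mulrC.
- apply/continuous_within_itvP => //; split.
  + by move=> x; rewrite in_itv/= => /andP[x0 _]; exact/cF/ltW.
  + exact/cvg_at_right_filter/cF.
  + exact/cvg_at_left_filter/cF.
- split.
  + move=> x; rewrite in_itv/= => /andP[x0 _].
    by apply: derivableM => //; have [] := dF (e + 1) x (ltW x0).
  + apply: cvg_at_right_filter; apply: cvgM; [exact: cvg_cst|exact: cF].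
  + apply: cvg_at_left_filter; apply: cvgM; [exact: cvg_cst|exact: cF].
- move=> x; rewrite in_itv/= => /andP[x0 _].
  have [dx Dx] := dF (e + 1) x (ltW x0).
  rewrite derive1E deriveZ//= Dx addrK /GRing.scale/=; field.
  by rewrite !gt_eqF.
Qed.

End power_integrals.

(** * Hoelder's inequality for p-th powers *)

Section Hoelder_inequality.
Context {d} {T : measurableType d} {R : realType} (mu : {measure set T -> \bar R}).

Lemma hoelder_powR (D : set T) (f g : T -> R) (p q : R) : measurable D ->
  measurable_fun D f -> measurable_fun D g -> 0 < p -> 0 < q ->
  p^-1 + q^-1 = 1 ->
  ((\int[mu]_(x in D) `|f x * g x|%:E) `^ p <=
   (\int[mu]_(x in D) (`|f x| `^ p)%:E) *
   (\int[mu]_(x in D) (`|g x| `^ q)%:E) `^ (p / q))%E.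
Proof.
move=> mD mf mg p0 q0 pq.
have mfD : measurable_fun setT (f \_ D) by apply/(measurable_restrictT f).
have mgD : measurable_fun setT (g \_ D) by apply/(measurable_restrictT g).
have := hoelder mu mfD mgD p0 q0 pq.
rewrite Lnorm1 [in X in (_ <= X)%E]unlock => H.
(* Extending by zero outside [D] adds 0^s to the integrand, which vanishes because s > 0. *)
have Ep (h : T -> R) (s : R) : 0 < s -> (\int[mu]_(x in D) (`|h x| `^ s)%:E =
    \int[mu]_x `|(EFin \o h \_ D) x| `^ s)%E.
  move=> s0; rewrite integral_mkcond; apply: eq_integral => x _.
  rewrite /= !patchE; case: ifP => // _.
  by rewrite normr0 powR0// gt_eqF.
have E1 : (\int[mu]_(x in D) `|f x * g x|%:E =
    \int[mu]_x `|(EFin \o (f \_ D \* g \_ D)%R) x|)%E.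
  rewrite integral_mkcond; apply: eq_integral => x _.
  by rewrite /= !patchE; case: ifP => // _; rewrite mulr0 normr0.
rewrite E1 !Ep//.
have h0 (h : T -> R) (s : R) : (0 <= \int[mu]_x `|(EFin \o h) x| `^ s)%E.
  by apply: integral_ge0 => x _; exact: poweR_ge0.
apply: (@le_trans _ _ (((\int[mu]_x `|(EFin \o f \_ D) x| `^ p) `^ p^-1 *
   (\int[mu]_x `|(EFin \o g \_ D) x| `^ q) `^ q^-1) `^ p))%E.
  apply: gt0_ler_poweR (H); first exact: ltW.
    by rewrite in_itv/= leey andbT integral_ge0.
  by rewrite in_itv/= leey andbT mule_ge0// poweR_ge0.
have root0 (y : \bar R) : (0 <= y)%E -> ((y `^ p^-1) `^ p)%E = y.
  by move=> y0; rewrite -poweRrM mulVf ?gt_eqF// poweRe1.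
rewrite poweRM; [|exact: poweR_ge0|exact: poweR_ge0].
by rewrite root0 ?h0// -poweRrM [q^-1 * p]mulrC.
Qed.

End Hoelder_inequality.

Section Taylor.
Context {R : realType}.
Local Notation mu := (@lebesgue_measure R).

(** The Taylor polynomial of degree below [n] about the moving centre x + hs, evaluated at x + h.
    For n > 0 it leads from the polynomial centred at x (s = 0) to the value f(x + h) (s = 1), and
    its derivative in s telescopes to a single term. *)
Definition taylor_path (f : R -> R) (x h : R) (n : nat) (s : R) : R :=
  \sum_(0 <= k < n) (1 - s) ^+ k / k`!%:R * h ^+ k * derive1n k f (x + h * s).

Lemma is_derive_taylor_path (f : R -> R) (x h s : R) (n : nat) :
  (forall k, (k <= n)%N -> forall x, derivable (derive1n k f) x 1) ->
  is_derive s 1 (taylor_path f x h n.+1)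
    ((1 - s) ^+ n / n`!%:R * h ^+ n.+1 * derive1n n.+1 f (x + h * s)).
Proof.
have dcomp k : (forall x, derivable (derive1n k f) x 1) ->
    is_derive s 1 (fun s => derive1n k f (x + h * s))
      (derive1n k.+1 f (x + h * s) * h).
  move=> dk.
  apply: (@is_derive1_comp _ (derive1n k f) (fun s => x + h * s)).
    by rewrite derive1nS derive1E; exact/derivableP/dk.
  by apply: is_derive_eq; rewrite /GRing.scale/=; ring.
elim: n => [|n ih] df.
  have := dcomp 0%N (df 0%N (leqnn _)).
  rewrite (_ : taylor_path f x h 1 = fun s => derive1n 0 f (x + h * s)).
    by rewrite expr0 fact0 divr1 mul1r expr1 mulrC.
  by apply/funext => t; rewrite /taylor_path big_nat1 fact0 !expr0 divr1 !mul1r.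
rewrite (_ : taylor_path f x h n.+2 = (fun s => taylor_path f x h n.+1 s +
   (1 - s) ^+ n.+1 / n.+1`!%:R * h ^+ n.+1 * derive1n n.+1 f (x + h * s))); last first.
  by apply/funext => t; rewrite /taylor_path big_nat_recr.
have d1 := ih (fun k kn => df k (leqW kn)).
have d2 := dcomp n.+1 (df n.+1 (leqnn _)).
(* Differentiating the new coefficient produces the negative of the one term left by the induction
   hypothesis; the two cancel. *)
have d3 : is_derive s 1 (fun s : R => (1 - s) ^+ n.+1 / n.+1`!%:R * h ^+ n.+1)
    (- ((1 - s) ^+ n / n`!%:R * h ^+ n.+1)).
  have e1 : is_derive s 1 (fun s : R => 1 - s) (-1).
    apply: is_derive_eq. by rewrite add0r mul1r.
  have e2 := is_deriveX n.+1 e1.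
  have e3 := is_deriveZ (h ^+ n.+1 / n.+1`!%:R) e2.
  rewrite (_ : (fun _ => _) =
      (h ^+ n.+1 / n.+1`!%:R) \*: ((fun s : R => 1 - s) ^+ n.+1)); last first.
    by apply/funext => t; rewrite exprfctE /= /GRing.scale/=; ring.
  apply: is_derive_eq.
  rewrite /GRing.scale/= factS natrM; field.
  by rewrite nat1r !pnatr_eq0 -lt0n fact_gt0.
apply: is_derive_eq.
rewrite /GRing.scale [h ^+ n.+2]exprS /=; ring.
Qed.

End Taylor.

(** * Integral form and pointwise bound of the combined remainder *)

Section Taylor_remainder.
Context {R : realType}.
Local Notation mu := (@lebesgue_measure R).
Implicit Types (f g : R -> R) (x t s : R) (r n : nat).

Lemma is_derive_bigsum (I : Type) (l : seq I) (h : I -> R -> R) (dh : I -> R) s :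
  (forall i, is_derive s 1 (h i) (dh i)) ->
  is_derive s 1 (fun s => \sum_(i <- l) h i s) (\sum_(i <- l) dh i).
Proof.
move=> dhs; elim: l => [|i l ih].
  rewrite big_nil (_ : (fun _ => _) = cst 0); first exact: is_derive_cst.
  by apply/funext => y; rewrite big_nil.
rewrite big_cons (_ : (fun _ => _) = h i \+ (fun s => \sum_(j <- l) h j s)).
  exact: is_deriveD.
by apply/funext => y; rewrite big_cons.
Qed.

Lemma continuous_bigsum (I : Type) (l : seq I) (h : I -> R -> R) :
  (forall i, continuous (h i)) -> continuous (fun s => \sum_(i <- l) h i s).
Proof.
move=> ch; elim: l => [|i l ih].
  rewrite (_ : (fun _ => _) = cst 0); first by move=> y; exact: cvg_cst.
  by apply/funext => y; rewrite big_nil.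
rewrite (_ : (fun _ => _) = h i \+ (fun s => \sum_(j <- l) h j s)).
  by move=> y; apply: continuousD; [exact: ch|exact: ih].
by apply/funext => y; rewrite big_cons.
Qed.

Lemma continuous_cstM (c : R) (h : R -> R) :
  continuous h -> continuous (fun s => c * h s).
Proof. by move=> ch s; apply: cvgM; [exact: cvg_cst|exact: ch]. Qed.

Lemma continuous_fdiff r g x t : continuous g ->
  continuous (fun s => fdiff r (t * s) g x).
Proof.
move=> cg; apply: (@continuous_bigsum _ _
  (fun j s => (-1) ^+ (r - j) * 'C(r, j)%:R * g (x + j%:R * (t * s)))) => j.
apply: continuous_cstM => y.
apply: (@continuous_comp _ _ _ (fun s => x + j%:R * (t * s)) g); last exact: cg.
exact: (cvgD (cvg_cst _) (cvgM (cvg_cst _) (cvgM (cvg_cst _) cvg_id))).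
Qed.

(** For r > 0 the coefficients of the difference add up to (1-1)^r = 0, so a constant may be
    subtracted from [g]; the term j = 0 then disappears. *)
Lemma fdiff_sub_cst r g x t : (0 < r)%N ->
  \sum_(1 <= j < r.+1) (-1) ^+ (r - j) * 'C(r, j)%:R * (g (x + j%:R * t) - g x)
  = fdiff r t g x.
Proof.
move=> r0; have coef0 : \sum_(0 <= j < r.+1) (-1) ^+ (r - j) * 'C(r, j)%:R = 0 :> R.
  transitivity ((-1 + 1 : R) ^+ r); last by rewrite addNr expr0n gtn_eqF.
  rewrite exprDn big_mkord; apply: eq_bigr => i _.
  by rewrite expr1n mulr1 mulr_natr.
transitivity (\sum_(0 <= j < r.+1)
    (-1) ^+ (r - j) * 'C(r, j)%:R * (g (x + j%:R * t) - g x)).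
  by rewrite [RHS]big_ltn// mul0r addr0 subrr mulr0 add0r.
rewrite (eq_bigr _ (fun j _ => mulrBr _ _ _)) sumrB.
by rewrite -mulr_suml coef0 mul0r subr0.
Qed.

(** The term of order [n] itself is subtracted too. This replaces g(x+jts) by g(x+jts) - g(x) in the
    integral form, where g is the n-th derivative, and so yields a complete difference of order
    [r]. *)
Definition taylor_rem r n f x t : R :=
  \sum_(0 <= j < r.+1) alphaj R r n j * f (x + j%:R * t) - f x
  - \sum_(1 <= k < n.+1) derive1n k f x * deltak R r n k / k`!%:R * t ^+ k.

Lemma continuous_onemX n : continuous (fun s : R => (1 - s) ^+ n).
Proof.
move=> s; apply: (@continuous_comp _ _ _ (fun s : R => 1 - s) (fun y => y ^+ n)).
  exact: (cvgB (cvg_cst _) cvg_id).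
exact: exprn_continuous.
Qed.

Lemma taylor_rem_integral r n f x t : (0 < r)%N -> Cn n.+1 f ->
  ((taylor_rem r n.+1 f x t)%:E = \int[mu]_(s in `[0%R, 1%R])
    (t ^+ n.+1 / n`!%:R *
      (fdiff r (t * s) (derive1n n.+1 f) x * (1 - s) ^+ n))%:E)%E.
Proof.
move=> r0 [df cf]; set g := derive1n n.+1 f.
pose al j : R := (-1) ^+ (r - j) * 'C(r, j)%:R * (j%:R ^- n.+1).
have alE (F : nat -> R) : \sum_(1 <= j < r.+1) alphaj R r n.+1 j * F j =
    \sum_(1 <= j < r.+1) al j * F j.
  by apply: eq_big_nat => j /andP[j1 _]; rewrite /alphaj gtn_eqF.
(* [Phi] is an explicit primitive of the integrand. The second summand of [phi] accounts for the
   subtracted term of order [n.+1]: it equals that term at s = 0 and vanishes at s = 1. *)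
pose phi j s := al j * (taylor_path f x (j%:R * t) n.+1 s +
  g x * (j%:R * t) ^+ n.+1 / n.+1`!%:R * (1 - s) ^+ n.+1).
pose Phi s := \sum_(1 <= j < r.+1) phi j s.
have dPhi s : is_derive s 1 Phi (t ^+ n.+1 / n`!%:R *
    (fdiff r (t * s) g x * (1 - s) ^+ n)).
  have D : is_derive s 1 Phi (\sum_(1 <= j < r.+1) al j *
    ((1 - s) ^+ n / n`!%:R * (j%:R * t) ^+ n.+1 * g (x + j%:R * t * s) -
     g x * (j%:R * t) ^+ n.+1 / n`!%:R * (1 - s) ^+ n)).
    apply: is_derive_bigsum => j.
    have d1 := is_derive_taylor_path f x (j%:R * t) s n (fun k kn => df k kn).
    have e1 : is_derive s 1 (fun s : R => 1 - s) (-1).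
      by apply: is_derive_eq; rewrite add0r mul1r.
    have e2 := is_deriveX n.+1 e1.
    have e3 := is_deriveZ (g x * (j%:R * t) ^+ n.+1 / n.+1`!%:R) e2.
    have e4 := is_deriveZ (al j) (is_deriveD d1 e3).
    rewrite (_ : phi j = al j \*: (taylor_path f x (j%:R * t) n.+1 +
      (g x * (j%:R * t) ^+ n.+1 / (n.+1)`!%:R) \*: (fun s : R => 1 - s) ^+ n.+1)).
      apply: is_derive_eq; rewrite /GRing.scale/=; congr (_ * (_ + _)).
      rewrite factS natrM; field.
      by rewrite nat1r !pnatr_eq0 -lt0n fact_gt0.
    by apply/funext => y; rewrite /phi/= fctE exprfctE.
  apply: (is_derive_eq D).
  rewrite -fdiff_sub_cst// mulr_suml mulr_sumr; apply: eq_big_nat => j /andP[j1 _].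
  rewrite -[_ * t * s]mulrA /al exprMn; field.
  by rewrite expf_neq0 ?pnatr_eq0 -?lt0n// fact_gt0.
have cPhi : continuous Phi.
  move=> s; apply: differentiable_continuous; apply/derivable1_diffP.
  by have [] := dPhi s.
rewrite (@continuous_FTC2 _ _ Phi)//; first last.
- by move=> s _; rewrite derive1E; have [_ ->] := dPhi s.
- split.
  + by move=> s _; have [] := dPhi s.
  + exact/cvg_at_right_filter/cPhi.
  + exact/cvg_at_left_filter/cPhi.
- apply: continuous_subspaceT; apply: continuous_cstM => s.
  by apply: cvgM; [exact: continuous_fdiff|exact: continuous_onemX].
rewrite -EFinB; congr EFin.
have Phi1 : Phi 1 = \sum_(1 <= j < r.+1) al j * f (x + j%:R * t).
  apply: eq_bigr => j _; rewrite /phi subrr expr0n/= mulr0 addr0; congr (_ * _).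
  rewrite /taylor_path big_ltn// subrr !expr0 fact0 divr1 !mul1r mulr1 big1_seq ?addr0//.
  by move=> [|k]; rewrite mem_index_iota//= expr0n/= !mul0r.
have Phi0 : Phi 0 = f x * \sum_(1 <= j < r.+1) al j +
    \sum_(1 <= k < n.+2) derive1n k f x * deltak R r n.+1 k / k`!%:R * t ^+ k.
  transitivity (\sum_(1 <= j < r.+1) \sum_(0 <= k < n.+2)
      al j * (derive1n k f x / k`!%:R * (j%:R * t) ^+ k)).
    apply: eq_bigr => j _; rewrite /phi -mulr_sumr big_nat_recr//=; congr (_ * (_ + _)).
      by apply: eq_bigr => k _; rewrite subr0 expr1n mulr0 addr0 mul1r; ring.
    by rewrite subr0 expr1n mulr1 mulrAC.
  rewrite exchange_big/= big_ltn//; congr (_ + _).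
    by rewrite mulr_sumr; apply: eq_bigr => j _; rewrite fact0 expr0 divr1 mulr1 mulrC.
  apply: eq_bigr => k _; rewrite /deltak alE mulr_sumr !mulr_suml.
  by apply: eq_bigr => j _; rewrite exprMn; ring.
rewrite Phi1 Phi0 /taylor_rem big_ltn// mul0r addr0 alE.
(* This value of alpha_0 makes the terms of order 0 cancel. *)
have -> : alphaj R r n.+1 0 = 1 - \sum_(1 <= j < r.+1) al j by [].
ring.
Qed.

Lemma taylor_rem_bound r n f x t (p q : R) : (0 < r)%N -> Cn n.+1 f ->
  0 < p -> 0 < q -> p^-1 + q^-1 = 1 ->
  ((`|taylor_rem r n.+1 f x t| `^ p)%:E <=
   ((n`!%:R `^ p * (q * n%:R + 1) `^ (p / q))^-1 * `|t| `^ (n.+1%:R * p))%:E *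
   \int[mu]_(s in `[0%R, 1%R]) (`|fdiff r (t * s) (derive1n n.+1 f) x| `^ p)%:E)%E.
Proof.
move=> r0 Cf p0 q0 pq; have [_ cf] := Cf; set g := derive1n n.+1 f.
pose F s := fdiff r (t * s) g x; pose G s : R := (1 - s) ^+ n.
have mF D : measurable_fun D F.
  by apply: measurable_funTS; apply: continuous_measurable_fun; exact: continuous_fdiff.
have mG D : measurable_fun D G.
  by apply: measurable_funTS; apply: continuous_measurable_fun; exact: continuous_onemX.
have qn1 : 0 < q * n%:R + 1 by rewrite ltr_wpDl// mulr_ge0// ltW.
have fact0 : 0 < n`!%:R :> R by rewrite ltr0n fact_gt0.
pose c := `|t| ^+ n.+1 / n`!%:R.
have c0 : 0 <= c by rewrite divr_ge0// ltW.
have IG : (\int[mu]_(s in `[0%R, 1%R]) (`|G s| `^ q)%:E = ((q * n%:R + 1)^-1)%:E)%E.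
  rewrite -(integral_onem_powR01 (q * n%:R)); last by rewrite mulr_ge0// ltW.
  apply: eq_integral => s; rewrite inE/= in_itv/= => /andP[s0 s1].
  have s10 : 0 <= 1 - s by rewrite subr_ge0.
  by rewrite /G ger0_norm ?exprn_ge0// -powR_mulrn// -powRrM mulrC.
have le1 : (`|taylor_rem r n.+1 f x t|%:E <=
    c%:E * \int[mu]_(s in `[0%R, 1%R]) `|F s * G s|%:E)%E.
  rewrite -abse_EFin (taylor_rem_integral _ _ _ _ _ r0 Cf).
  apply: (le_trans (le_abse_integral _ _ _)) => //.
    apply/measurable_EFinP; apply: measurable_funM => //.
    exact: (measurable_funM (mF _) (mG _)).
  rewrite -ge0_integralZl//=; last first.
    apply/measurable_EFinP; apply: measurableT_comp => //.
    exact: (measurable_funM (mF _) (mG _)).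
  rewrite le_eqVlt; apply/orP; left; apply/eqP; apply: eq_integral => s _.
  by rewrite -EFinM -[(1 - s) ^+ n]/(G s) -/(F s) normrM normrM normfV normrX
    (ger0_norm (ltW fact0)).
have I0 : (0 <= \int[mu]_(s in `[0%R, 1%R]) `|F s * G s|%:E)%E.
  by apply: integral_ge0 => s _; rewrite lee_fin.
rewrite -poweR_EFin.
apply: (@le_trans _ _ ((c%:E * \int[mu]_(s in `[0%R, 1%R]) `|F s * G s|%:E) `^ p)%E).
  apply: gt0_ler_poweR le1; first exact: ltW.
    by rewrite in_itv/= leey andbT lee_fin.
  by rewrite in_itv/= leey andbT mule_ge0.
rewrite poweRM ?lee_fin// poweR_EFin.
apply: (@le_trans _ _ ((c `^ p)%:E * ((\int[mu]_(s in `[0%R, 1%R]) (`|F s| `^ p)%:E) *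
   (\int[mu]_(s in `[0%R, 1%R]) (`|G s| `^ q)%:E) `^ (p / q)))%E).
  apply: lee_wpmul2l; first by rewrite lee_fin powR_ge0.
  have H := hoelder_powR mu `[0%R, 1%R] F G p q (measurable_itv _) (mF _) (mG _) p0 q0 pq.
  exact: H.
rewrite IG poweR_EFin [X in (_ * X)%E]muleC muleA -EFinM.
rewrite le_eqVlt; apply/orP; left; apply/eqP; congr (_%:E * _)%E.
have powVr (y z : R) : 0 < y -> y^-1 `^ z = (y `^ z)^-1.
  by move=> y0; rewrite -powR_inv1 ?(ltW y0)// -powRrM mulN1r powRN.
rewrite /c powRM ?invr_ge0 ?(ltW fact0)// -powR_mulrn// -powRrM !powVr//.
by rewrite invfM; ring.
Qed.

End Taylor_remainder.

(** * Gamma and Beta integrals *)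

Section Gamma_function.
Context {R : realType}.
Local Notation mu := (@lebesgue_measure R).
Implicit Types (s c : R).

Lemma measurable_gamma_integrand s :
  measurable_fun setT (fun t : R => t `^ (s - 1) * expR (- t)).
Proof.
apply: measurable_funM; first exact: measurable_powR.
exact: (measurableT_comp (@measurable_expR R) (@oppr_measurable R setT)).
Qed.

Lemma gamma_integrand_ge0 s (t : R) : 0 <= t `^ (s - 1) * expR (- t).
Proof. by rewrite mulr_ge0 ?powR_ge0 ?expR_ge0. Qed.

Lemma powR_le_1Dexprn (t s : R) (N : nat) : 0 < t -> 0 <= s -> s <= N%:R ->
  t `^ s <= 1 + t ^+ N.
Proof.
move=> t0 s0 sN; have [t1|t1] := leP t 1.
  rewrite (@le_trans _ _ 1)//; last by rewrite lerDl exprn_ge0// ltW.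
  by rewrite -(powRr0 t) ger_powR ?t0.
rewrite (@le_trans _ _ (t ^+ N))//; last by rewrite lerDr.
by rewrite -powR_mulrn ?(ltW t0)// ler_powR// ltW.
Qed.

(* Makes [t^(s-1) exp(-t)] at most a multiple of the derivative of
   [- 1 / (1 + t^s)], whose increments are bounded by 1. *)
Lemma sqr_1DpowR_le_expR s : 0 < s ->
  exists2 M : R, 0 < M & forall t : R, 0 < t -> (1 + t `^ s) ^+ 2 <= M * expR t.
Proof.
move=> s0; pose N := (Num.truncn s).+1.
have sN : s <= N%:R by rewrite ltW// truncnS_gt.
pose K : R := 2 ^+ N * N`!%:R.
have K0 : 0 < K by rewrite mulr_gt0 ?exprn_gt0// ltr0n fact_gt0.
exists ((2 + K) ^+ 2); first by rewrite exprn_gt0// addr_gt0.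
move=> t t0; have -> : expR t = expR (t / 2) ^+ 2.
  by rewrite expr2 -expRD; congr expR; field.
rewrite -exprMn; apply: lerXn2r; rewrite ?nnegrE.
- by rewrite addr_ge0 ?powR_ge0.
- by rewrite mulr_ge0 ?expR_ge0// addr_ge0// ltW.
apply: (@le_trans _ _ (2 + t ^+ N)).
  by rewrite (_ : 2 = 1 + 1)// -addrA lerD2l powR_le_1Dexprn// ltW.
have E1 : 1 <= expR (t / 2) by rewrite -expR0 ler_expR divr_ge0// ltW.
rewrite mulrDl lerD//; first by rewrite ler_peMr.
have := expR_ge1Dxn (Num.truncn s) (divr_ge0 (ltW t0) (ler0n R 2)).
rewrite -/N => H.
have : (t / 2) ^+ N / N`!%:R <= expR (t / 2).
  by rewrite (le_trans _ H)// lerDr.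
rewrite ler_pdivrMr ?ltr0n ?fact_gt0// expr_div_n ler_pdivrMr ?exprn_gt0//.
by move=> /le_trans; apply; rewrite /K; rewrite le_eqVlt; apply/orP; left; apply/eqP; ring.
Qed.

Lemma is_derive_gamma_major s (t : R) : 0 < t ->
  is_derive t 1 (fun t : R => - (1 + t `^ s)^-1)
    (s * t `^ (s - 1) / (1 + t `^ s) ^+ 2).
Proof.
move=> t0.
have d1 := is_derive1_powR s t0.
have p0 : 1 + t `^ s != 0 by rewrite gt_eqF// ltr_pwDl// powR_ge0.
have d2 : is_derive t 1 (fun t : R => 1 + t `^ s) (s * t `^ (s - 1)).
  apply: (is_derive_eq (is_deriveD (is_derive_cst (1 : R) t 1) d1)).
  by rewrite add0r.
rewrite (_ : (fun _ => _) = - (fun y : R => (1 + y `^ s)^-1)); last by [].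
have d3 := @is_deriveV R (fun y : R => 1 + y `^ s) t _ 1 p0 d2.
apply: (is_derive_eq (is_deriveN d3)).
by rewrite /GRing.scale/= mulNr opprK mulrC.
Qed.

Lemma gamma_integral_lty s : 0 < s ->
  (\int[mu]_(t in `]0%R, +oo[) (t `^ (s - 1) * expR (- t))%:E < +oo)%E.
Proof.
move=> s0; have [M M0 HM] := sqr_1DpowR_le_expR s s0.
apply: (@le_lt_trans _ _ ((M / s)%:E)); last exact: ltry.
apply: ge0_integral_Ioi_le.
- by apply/measurable_EFinP; apply: measurable_funTS; exact: measurable_gamma_integrand.
- by move=> t _; rewrite lee_fin gamma_integrand_ge0.
move=> a b a0 ab.
pose f (t : R) := M / s * (s * t `^ (s - 1) / (1 + t `^ s) ^+ 2).
have pos (t : R) : t \in `[a, b] -> 0 < t.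
  by rewrite in_itv/= => /andP[at_ _]; rewrite (lt_le_trans a0).
have p0 (t : R) : 0 < 1 + t `^ s by rewrite ltr_pwDl// powR_ge0.
have cf (t : R) : 0 < t -> {for t, continuous f}.
  move=> t0; rewrite /f; apply: cvgM; first exact: cvg_cst.
  apply: cvgM.
    by apply: cvgM; [exact: cvg_cst|exact: continuous_powR_gt0].
  apply: cvgV; first by rewrite expf_neq0// gt_eqF.
  apply: (@continuous_comp _ _ _ (fun t : R => 1 + t `^ s) (fun y => y ^+ 2)).
    by apply: cvgD; [exact: cvg_cst|exact: continuous_powR_gt0].
  exact: exprn_continuous.
have dF (t : R) : 0 < t -> is_derive t 1 (fun t : R => M / s * - (1 + t `^ s)^-1) (f t).
  move=> t0; exact: (is_deriveZ (M / s) (is_derive_gamma_major s t t0)).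
have cF (t : R) : 0 < t ->
    {for t, continuous (fun t : R => M / s * - (1 + t `^ s)^-1)}.
  move=> t0; apply: differentiable_continuous; apply/derivable1_diffP.
  by have [] := dF t t0.
apply: (@le_trans _ _ (\int[mu]_(t in `[a, b]) (f t)%:E)%E).
  apply: ge0_le_integral => //=.
  - by move=> t _; rewrite lee_fin gamma_integrand_ge0.
  - by apply/measurable_EFinP; apply: measurable_funTS; exact: measurable_gamma_integrand.
  - apply/measurable_EFinP; apply: measurable_funTS; rewrite /f.
    apply: measurable_funM => //; apply: measurable_funM.
      by apply: measurable_funM => //; exact: measurable_powR.
    apply: ge0_measurable_funV => [t|]; first by rewrite exprn_ge0// ltW.
    apply: measurable_funX; apply: measurable_funD => //; exact: measurable_powR.
  - move=> t tab; have t0 := pos t tab; rewrite lee_fin /f expRN.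
    rewrite ler_pdivrMr ?expR_gt0//.
    have -> : M / s * (s * t `^ (s - 1) / (1 + t `^ s) ^+ 2) * expR t =
        t `^ (s - 1) * (M * expR t / (1 + t `^ s) ^+ 2).
      by field; rewrite !gt_eqF.
    by rewrite ler_peMr ?powR_ge0// ler_pdivlMr ?exprn_gt0// mul1r HM.
rewrite (@continuous_FTC2 _ _ (fun t : R => M / s * - (1 + t `^ s)^-1))//.
- rewrite -EFinB lee_fin -mulrBr opprK -[leRHS]mulr1.
  rewrite ler_wpM2l ?divr_ge0 ?(ltW M0) ?(ltW s0)//.
  rewrite (@le_trans _ _ ((1 + a `^ s)^-1))//.
    by rewrite gerDr oppr_le0 invr_ge0 ltW.
  by rewrite invf_le1// lerDl powR_ge0.
- apply: continuous_in_subspaceT => t; rewrite inE/= => /pos; exact: cf.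
- have b0 := lt_trans a0 ab.
  split.
  + move=> t; rewrite in_itv/= => /andP[at_ _].
    by have [] := dF t (lt_trans a0 at_).
  + exact/cvg_at_right_filter/cF.
  + exact/cvg_at_left_filter/cF.
- move=> t; rewrite in_itv/= => /andP[at_ _].
  by rewrite derive1E; have [_ ->] := dF t (lt_trans a0 at_).
Qed.

(** [Gamma] is a real-valued integral, set to 0 if the extended one is infinite; the convergence for
    s > 0 rules that case out. *)
Lemma GammaE s : 0 < s ->
  (\int[mu]_(t in `]0%R, +oo[) (t `^ (s - 1) * expR (- t))%:E = (Gamma s)%:E)%E.
Proof.
move=> s0; rewrite /Gamma /Rintegral fineK// ge0_fin_numE ?gamma_integral_lty//.
by apply: integral_ge0 => t _; rewrite lee_fin gamma_integrand_ge0.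
Qed.

Lemma Gamma_gt0 s : 0 < s -> 0 < Gamma s.
Proof.
move=> s0; rewrite -lte_fin -GammaE//; apply: integral_gt0 => //.
- by apply: measurable_funTS; exact: measurable_gamma_integrand.
- rewrite [X in (_ < X)%E](lebesgue_measure_itv `]0%R, +oo[)/=.
  by rewrite ltry addye// ltry.
- by move=> t; rewrite /= in_itv/= andbT => t0; rewrite mulr_gt0 ?powR_gt0 ?expR_gt0.
Qed.

Lemma eq_EFin_divr (c d : R) (I : \bar R) : c != 0 ->
  (c%:E * I = d%:E)%E -> I = (d / c)%:E.
Proof.
by move=> c0 H; rewrite mulrC EFinM -H muleA -EFinM mulVf// mul1e.
Qed.

(** Read from right to left, this writes the power c^(-s) as a superposition of exponentials. With c
    = t^m + 1 it replaces the denominator of a Beta integral by an exponential that splits into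
    factors. *)
Lemma Gamma_scale s c : 0 < s -> 0 < c ->
  (\int[mu]_(t in `]0%R, +oo[) (t `^ (s - 1) * expR (- (c * t)))%:E =
   (Gamma s * c `^ (- s))%:E)%E.
Proof.
move=> s0 c0.
have mG : measurable_fun setT (fun t : R => (t `^ (s - 1) * expR (- t))%:E).
  by apply/measurable_EFinP; exact: measurable_gamma_integrand.
have := ge0_integral_Ioi_scale c _ c0 mG
  (fun t => eq_ind_r is_true (gamma_integrand_ge0 s t) (lee_fin _ _)).
rewrite GammaE//.
rewrite (_ : (\int[mu]_(x in _) _ = (c `^ (s - 1))%:E *
  \int[mu]_(t in `]0%R, +oo[) (t `^ (s - 1) * expR (- (c * t)))%:E)%E); last first.
  rewrite -ge0_integralZl//=.
  - apply: eq_integral => t; rewrite inE/= in_itv/= andbT => t0.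
    by rewrite powRM ?(ltW t0) ?(ltW c0)// -EFinM mulrA.
  - apply/measurable_EFinP; apply: measurable_funTS; apply: measurable_funM.
      exact: measurable_powR.
    apply: (measurableT_comp (@measurable_expR R)).
    by apply: (measurableT_comp (@oppr_measurable R setT)); exact: measurable_funM.
  - by move=> t _; rewrite lee_fin mulr_ge0 ?powR_ge0 ?expR_ge0.
  - by rewrite lee_fin powR_ge0.
move=> H; have cp : 0 < c `^ (s - 1) by exact: powR_gt0.
rewrite (eq_EFin_divr _ _ _ (lt0r_neq0 cp) H); congr EFin.
rewrite mulrAC -powR_inv1 ?(ltW c0)//. rewrite -powRN -powRD.
  by rewrite mulrC; congr (_ * _ `^ _); lra.
by rewrite (gt_eqF c0) implybT.
Qed.

(* Tonelli for [t^(s-1) u^(g-1) exp(-(t^m+1)u)] on the positive quadrant. *)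
Lemma beta_integral (m : nat) (s g : R) : (0 < m)%N -> 0 < s -> s / m%:R < g ->
  (\int[mu]_(t in `]0%R, +oo[) (t `^ (s - 1) / (t ^+ m + 1) `^ g)%:E =
   (Gamma (s / m%:R) * Gamma (g - s / m%:R) / (m%:R * Gamma g))%:E)%E.
Proof.
move=> m0 s0 sg.
have mR : 0 < m%:R :> R by rewrite ltr0n.
have sm : 0 < s / m%:R by rewrite divr_gt0.
have g0 : 0 < g by exact: lt_trans sg.
have Gg := Gamma_gt0 g g0.
have gs : 0 < g - s / m%:R by rewrite subr_gt0.
pose f (z : R * R) : \bar R :=
  (z.1 `^ (s - 1) * (z.2 `^ (g - 1) * expR (- ((z.1 ^+ m + 1) * z.2))))%:E.
have mf : measurable_fun setT f.
  apply/measurable_EFinP; apply: measurable_funM.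
    exact: (measurableT_comp (measurable_powR (s - 1)) measurable_fst).
  apply: measurable_funM.
    exact: (measurableT_comp (measurable_powR (g - 1)) measurable_snd).
  apply: (measurableT_comp (@measurable_expR R)).
  apply: (measurableT_comp (@oppr_measurable R setT)).
  apply: measurable_funM; last exact: measurable_snd.
  by apply: measurable_funD => //; apply: measurable_funX; exact: measurable_fst.
have f0 z : (0 <= f z)%E by rewrite lee_fin !mulr_ge0 ?powR_ge0 ?expR_ge0.
have := fubini_tonelliD mu mu `]0%R, +oo[%classic `]0%R, +oo[%classic f
  (measurable_itv _) (measurable_itv _) mf f0.
have -> : (\int[mu]_(x in `]0%R, +oo[) \int[mu]_(y in `]0%R, +oo[) f (x, y) =
  (Gamma g)%:E * \int[mu]_(t in `]0%R, +oo[) (t `^ (s - 1) / (t ^+ m + 1) `^ g)%:E)%E.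
  rewrite -ge0_integralZl//=; last 3 first.
  - apply/measurable_EFinP; apply: measurable_funTS; apply: measurable_funM.
      exact: measurable_powR.
    apply: ge0_measurable_funV => [t|]; first exact: powR_ge0.
    apply: (measurableT_comp (measurable_powR g)).
    by apply: measurable_funD => //; exact: measurable_funX.
  - by move=> t _; rewrite lee_fin divr_ge0 ?powR_ge0.
  - by rewrite lee_fin ltW.
  apply: eq_integral => t; rewrite inE/= in_itv/= andbT => t0.
  have t1 : 0 < t ^+ m + 1 by rewrite addr_gt0 ?exprn_gt0.
  rewrite /f/=; under eq_integral do rewrite EFinM.
  rewrite ge0_integralZl//=; last 3 first.
  - apply/measurable_EFinP; apply: measurable_funTS; apply: measurable_funM.
      exact: measurable_powR.
    apply: (measurableT_comp (@measurable_expR R)).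
    by apply: (measurableT_comp (@oppr_measurable R setT)); exact: measurable_funM.
  - by move=> u _; rewrite lee_fin mulr_ge0 ?powR_ge0 ?expR_ge0.
  - by rewrite lee_fin powR_ge0.
  by rewrite Gamma_scale// -!EFinM powRN; congr EFin; ring.
have -> : (\int[mu]_(y in `]0%R, +oo[) \int[mu]_(x in `]0%R, +oo[) f (x, y) =
  (m%:R^-1 * Gamma (s / m%:R) * Gamma (g - s / m%:R))%:E)%E.
  (* With y = t^m the inner integral becomes a Gamma integral with parameter s/m. The factor
     u^(-s/m) that it releases lowers the parameter of the outer Gamma integral from g to g -
     s/m. *)
  have inner (u : R) : 0 < u ->
      (\int[mu]_(t in `]0%R, +oo[) (t `^ (s - 1) * expR (- (t ^+ m * u)))%:E =
      (m%:R^-1 * Gamma (s / m%:R) * u `^ (- (s / m%:R)))%:E)%E.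
    move=> u0; rewrite -mulrA EFinM -Gamma_scale//.
    rewrite (ge0_integral_Ioi_exprn m
      (fun y => y `^ (s / m%:R - 1) * expR (- (u * y))))//; last 3 first.
    - move=> y y0; apply: cvgM.
        exact: continuous_powR_gt0.
      have cN : {for y, continuous (fun y : R => - (u * y))}.
        exact: (cvgN (cvgM (cvg_cst u) cvg_id)).
      by apply: cvg_comp; [exact: cN|exact: continuous_expR].
    - by move=> y _; rewrite mulr_ge0 ?powR_ge0 ?expR_ge0.
    - apply: measurable_funM; first exact: measurable_powR.
      apply: (measurableT_comp (@measurable_expR R)).
      by apply: (measurableT_comp (@oppr_measurable R setT)); exact: measurable_funM.
    rewrite -ge0_integralZl//=; last 2 first.
    - apply/measurable_EFinP; apply: measurable_funTS; apply: measurable_funM.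
        apply: measurable_funM.
          by apply: (measurableT_comp (measurable_powR _)); exact: measurable_funX.
        apply: (measurableT_comp (@measurable_expR R)).
        apply: (measurableT_comp (@oppr_measurable R setT)).
        by apply: measurable_funM => //; exact: measurable_funX.
      by apply: measurable_funM => //; exact: measurable_funX.
    - move=> t; rewrite in_itv/= andbT => t0.
      by rewrite lee_fin !mulr_ge0 ?powR_ge0 ?expR_ge0// exprn_ge0// ltW.
    apply: eq_integral => t; rewrite inE/= in_itv/= andbT => t0.
    rewrite -EFinM [u * _]mulrC; congr EFin.
    have -> : t `^ (s - 1) = (t ^+ m) `^ (s / m%:R - 1) * t ^+ m.-1.
      rewrite -!powR_mulrn ?(ltW t0)// -powRrM -powRD; last by rewrite (gt_eqF t0) implybT.
      congr (_ `^ _); rewrite -[in RHS](prednK m0) -natr1; field.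
      by rewrite natr1 prednK// gt_eqF.
    by field; rewrite gt_eqF.
  rewrite EFinM -(GammaE (g - s / m%:R))// -ge0_integralZl//=; last 3 first.
  - by apply/measurable_EFinP; apply: measurable_funTS; exact: measurable_gamma_integrand.
  - by move=> u _; rewrite lee_fin gamma_integrand_ge0.
  - by rewrite lee_fin mulr_ge0 ?invr_ge0 ?ltW// Gamma_gt0.
  apply: eq_integral => u; rewrite inE/= in_itv/= andbT => u0.
  transitivity ((u `^ (g - 1) * expR (- u))%:E *
    \int[mu]_(t in `]0%R, +oo[) (t `^ (s - 1) * expR (- (t ^+ m * u)))%:E)%E.
    rewrite -ge0_integralZl//=; last 3 first.
    - apply/measurable_EFinP; apply: measurable_funTS; apply: measurable_funM.
        exact: measurable_powR.
      apply: (measurableT_comp (@measurable_expR R)).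
      apply: (measurableT_comp (@oppr_measurable R setT)).
      by apply: measurable_funM => //; exact: measurable_funX.
    - by move=> t _; rewrite lee_fin mulr_ge0 ?powR_ge0 ?expR_ge0.
    - by rewrite lee_fin gamma_integrand_ge0.
    apply: eq_integral => t _; rewrite /f/= -EFinM mulrDl mul1r opprD expRD.
    by congr EFin; ring.
  rewrite inner// -EFinM.
  have -> : u `^ (g - s / m%:R - 1) = u `^ (g - 1) * u `^ (- (s / m%:R)).
    rewrite -powRD; last by rewrite (gt_eqF u0) implybT.
    by congr (_ `^ _); lra.
  by congr EFin; ring.
move=> /(eq_EFin_divr _ _ _ (lt0r_neq0 Gg)) ->.
congr EFin; move: (Gamma g) (Gamma (_ / _)) (Gamma (g - _)) Gg => x y z x0.
by field; rewrite (gt_eqF mR) (gt_eqF x0).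
Qed.

End Gamma_function.

(** * The operator as a weighted integral of the Taylor remainder *)

Section weight.
Context {R : realType}.
Local Notation mu := (@lebesgue_measure R).
Implicit Types (a k m : nat) (b u : R).

(** The exponent is kept as a parameter because it takes the values [beta], [beta / 2],
    [p * beta / 2] and [q * beta / 2] below. *)
Definition weight a b u : R := ((u ^+ (2 * a) + 1) `^ b)^-1.

Let base_gt0 a u : 0 < u ^+ (2 * a) + 1.
Proof. by rewrite ltr_wpDl// exprM exprn_ge0// sqr_ge0. Qed.

Lemma weight_gt0 a b u : 0 < weight a b u.
Proof. by rewrite invr_gt0 powR_gt0. Qed.

Lemma weightN a b u : weight a b (- u) = weight a b u.
Proof. by rewrite /weight !exprM sqrrN. Qed.

Lemma weightD a b c u : weight a (b + c) u = weight a b u * weight a c u.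
Proof. by rewrite /weight powRD ?invfM// (gt_eqF (base_gt0 a u)) implybT. Qed.

Lemma weight_powR a b c u : weight a b u `^ c = weight a (b * c) u.
Proof. by rewrite /weight -!powRN -powRrM mulNr. Qed.

Lemma measurable_weight a b : measurable_fun setT (weight a b).
Proof.
apply: ge0_measurable_funV => [u|]; first exact: powR_ge0.
apply: (measurableT_comp (measurable_powR b)).
by apply: measurable_funD => //; exact: measurable_funX.
Qed.

(** Evenness doubles the Beta integral with s = k+1 and m = 2a; the 2 cancels against the one in
    m. *)
Lemma integral_normX_weight a k b : (0 < a)%N -> k.+1%:R / (2 * a%:R) < b ->
  (\int[mu]_u (`|u| ^+ k * weight a b u)%:E =
   (Gamma (k.+1%:R / (2 * a%:R)) * Gamma (b - k.+1%:R / (2 * a%:R))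
     / (a%:R * Gamma b))%:E)%E.
Proof.
move=> a0 kb; have aR : 0 < a%:R :> R by rewrite ltr0n.
rewrite ge0_integral_even; last 3 first.
- apply/measurable_EFinP; apply: measurable_funM; last exact: measurable_weight.
  by apply: measurable_funX; exact: normr_measurable.
- by move=> u; rewrite lee_fin mulr_ge0 ?exprn_ge0// ltW// weight_gt0.
- by move=> u; rewrite normrN weightN.
rewrite (_ : (\int[mu]_(u in _) _ = \int[mu]_(t in `]0%R, +oo[)
  (t `^ (k.+1%:R - 1) / (t ^+ (2 * a) + 1) `^ b)%:E)%E); last first.
  apply: eq_integral => t; rewrite inE/= in_itv/= andbT => t0.
  by rewrite -natr1 addrK powR_mulrn ?(ltW t0)// gtr0_norm.
rewrite beta_integral ?muln_gt0// ?natrM//.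
have b0 : 0 < b by rewrite (le_lt_trans _ kb)// divr_ge0// mulr_ge0// ltW.
rewrite -EFinM; congr EFin.
move: (Gamma b) (Gamma (_ / _)) (Gamma (b - _)) (Gamma_gt0 b b0) => g x y g0.
by field; rewrite (gt_eqF aR) (gt_eqF g0).
Qed.

Lemma integrable_expr_weight a k b : (0 < a)%N -> k.+1%:R / (2 * a%:R) < b ->
  mu.-integrable setT (EFin \o (fun u => u ^+ k * weight a b u)).
Proof.
move=> a0 kb; apply/integrableP; split.
  apply/measurable_EFinP; apply: measurable_funM; last exact: measurable_weight.
  exact: measurable_funX.
under eq_integral => u _
  do rewrite /= normrM normrX (ger0_norm (ltW (weight_gt0 _ _ _))).
by rewrite integral_normX_weight// ltry.
Qed.

Lemma Rintegral_even_expr_weight a m b : (0 < a)%N ->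
  (2 * m + 1)%:R / (2 * a%:R) < b ->
  \int[mu]_u (u ^+ (2 * m) * weight a b u) =
  Gamma ((2 * m + 1)%:R / (2 * a%:R)) * Gamma (b - (2 * m + 1)%:R / (2 * a%:R))
     / (a%:R * Gamma b).
Proof.
move=> a0; rewrite addn1 => mb; rewrite /Rintegral.
under eq_integral => u _ do rewrite exprM -(real_normK (num_real u)) -exprM.
by rewrite integral_normX_weight.
Qed.

Lemma Rintegral_odd_expr_weight a k b : (0 < a)%N -> odd k ->
  k.+1%:R / (2 * a%:R) < b -> \int[mu]_u (u ^+ k * weight a b u) = 0.
Proof.
move=> a0 ok kb; rewrite /Rintegral integral_odd//.
- apply/measurable_EFinP; apply: measurable_funM; last exact: measurable_weight.
  exact: measurable_funX.
- by move=> u; rewrite weightN exprNn -signr_odd ok expr1 mulN1r mulNr EFinN.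
- exact: integrable_expr_weight.
Qed.

End weight.

Lemma big_even_nat {V : nmodType} (F : nat -> V) (n : nat) :
  (forall k, (k <= n)%N -> odd k -> F k = 0) ->
  \sum_(1 <= k < n.+1) F k = \sum_(1 <= m < (n./2).+1) F (2 * m)%N.
Proof.
elim: n => [|n ih] F0; first by rewrite !big_geq.
rewrite big_nat_recr//= ih => [|k kn]; last by apply: F0; exact: leqW.
rewrite uphalf_half; case on : (odd n).
  rewrite add1n [RHS]big_nat_recr//=; congr (_ + F _).
  by rewrite -[in LHS](odd_double_half n) on -mul2n; lia.
by rewrite add0n F0 ?addr0//= on.
Qed.

Section Delta_identity.
Context {R : realType}.
Local Notation mu := (@lebesgue_measure R).
Variables (r n a : nat) (beta : R) (f : R -> R).
Hypotheses (a0 : (0 < a)%N) (nb : n.+1%:R / (2 * a%:R) < beta) (Cf : Cn n f).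

(** [Wc] at [xi] equal to 1; it normalizes [weight a beta] to total mass 1. *)
Definition wconst : R :=
  Gamma beta * a%:R / (Gamma (1 / (2 * a%:R)) * Gamma (beta - 1 / (2 * a%:R))).

Let aR : 0 < a%:R :> R. Proof. by rewrite ltr0n. Qed.

Let kb k : (k <= n)%N -> k.+1%:R / (2 * a%:R) < beta.
Proof.
move=> kn; apply: le_lt_trans nb.
by rewrite ler_pM2r ?invr_gt0 ?mulr_gt0// ler_nat ltnS.
Qed.

Let gt01 : 0 < 1 / (2 * a%:R) :> R. Proof. by rewrite divr_gt0// mulr_gt0. Qed.
Let b1 : 1 / (2 * a%:R) < beta. Proof. exact: (kb 0%N). Qed.
Let beta0 : 0 < beta. Proof. exact: lt_trans b1. Qed.
Let G1 : 0 < Gamma (1 / (2 * a%:R) : R). Proof. exact: Gamma_gt0. Qed.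
Let G2 : 0 < Gamma (beta - 1 / (2 * a%:R)).
Proof. by apply: Gamma_gt0; rewrite subr_gt0. Qed.
Let G3 : 0 < Gamma beta. Proof. exact: Gamma_gt0. Qed.

Lemma wconst_gt0 : 0 < wconst.
Proof. exact: divr_gt0 (mulr_gt0 G3 aR) (mulr_gt0 G1 G2). Qed.

Lemma continuous_Cn_derive1n k : (k <= n)%N -> continuous (derive1n k f).
Proof.
case: Cf => df cf; rewrite leq_eqVlt => /predU1P[-> //|kn] x.
by apply: differentiable_continuous; apply/derivable1_diffP; exact: df.
Qed.

Lemma measurable_Cn_derive1n k : (k <= n)%N -> measurable_fun setT (derive1n k f).
Proof. by move=> kn; apply: continuous_measurable_fun; exact: continuous_Cn_derive1n. Qed.

Let mf : measurable_fun setT f. Proof. exact: (measurable_Cn_derive1n 0). Qed.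

(** The arguments are measurable functions on an arbitrary space, so that one statement covers the
    sections in a single variable and the joint measurability needed for Tonelli's theorem. *)
Lemma measurable_taylor_rem (d : measure_display) (T : measurableType d) (X Y : T -> R) :
  measurable_fun setT X -> measurable_fun setT Y ->
  measurable_fun setT (fun z => taylor_rem r n f (X z) (Y z)).
Proof.
move=> mX mY; apply: measurable_funB; [apply: measurable_funB|].
- apply: measurable_sum => j; apply: measurable_funM => //.
  apply: (measurableT_comp mf); apply: measurable_funD => //.
  exact: measurable_funM.
- exact: (measurableT_comp mf).
- under eq_fun do rewrite big_add1 big_mkord.
  apply: measurable_sum => k; apply: measurable_funM; last exact: measurable_funX.
  apply: measurable_funM => //; apply: measurable_funM => //.
  by apply: (measurableT_comp _ mX); exact: measurable_Cn_derive1n.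
Qed.

Lemma Mop_scale (xi x : R) : 0 < xi ->
  mu.-integrable setT (EFin \o (fun u =>
    (\sum_(0 <= j < r.+1) alphaj R r n j * f (x + j%:R * (xi * u))) * weight a beta u)) ->
  Mop r n a beta xi f x = wconst * \int[mu]_u
    ((\sum_(0 <= j < r.+1) alphaj R r n j * f (x + j%:R * (xi * u))) * weight a beta u).
Proof.
move=> xi0 Ni.
pose N t := \sum_(0 <= j < r.+1) alphaj R r n j * f (x + j%:R * t).
have mN : measurable_fun setT N.
  apply: measurable_sum => j; apply: measurable_funM => //.
  by apply: (measurableT_comp mf); apply: measurable_funD.
pose g t := N t / (t ^+ (2 * a) + xi ^+ (2 * a)) `^ beta.
have mg : measurable_fun setT (EFin \o g).
  apply/measurable_EFinP; apply: measurable_funM => //.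
  apply: ge0_measurable_funV => [u|]; first exact: powR_ge0.
  apply: (measurableT_comp (measurable_powR beta)).
  by apply: measurable_funD => //; exact: measurable_funX.
have gE u : g (xi * u + 0) = xi `^ (- (2 * a%:R * beta)) * (N (xi * u) * weight a beta u).
  rewrite addr0 /g /weight exprMn -[X in _ + X]mulr1 -mulrDr powRM; last 2 first.
  - by rewrite exprn_ge0// ltW.
  - by rewrite addr_ge0// exprM exprn_ge0// sqr_ge0.
  rewrite -(powR_mulrn _ (ltW xi0)) -powRrM natrM invfM powRN; ring.
have := integral_affine xi 0 _ xi0 mg.
under eq_integral do rewrite /= gE EFinM.
rewrite (integralZl measurableT Ni) => E.
have If : (\int[mu]_u (N (xi * u) * weight a beta u)%:E =
    (\int[mu]_u (N (xi * u) * weight a beta u))%:E)%E.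
  by rewrite /Rintegral fineK//; exact: integrable_fin_num.
rewrite If -EFinM in E.
have xiV : xi^-1 != 0 by rewrite invr_neq0// gt_eqF.
have {}E := eq_EFin_divr _ _ _ xiV (esym E).
have -> : Mop r n a beta xi f x = Wc a beta xi * fine (\int[mu]_t (g t)%:E)%E.
  by [].
rewrite E [fine _]/=.
rewrite /wconst /Wc invrK.
(* The three powers of [xi] come from [Wc], from the rescaled weight and from dt = xi du. *)
have pw : xi `^ (2 * a%:R * beta - 1) * (xi `^ (- (2 * a%:R * beta)) * xi) = 1.
  rewrite -[X in _ * (_ * X)](powRr1 (ltW xi0)) -!powRD ?(gt_eqF xi0) ?implybT//.
  by rewrite -(powRr0 xi); congr (_ `^ _); ring.
set I := Rintegral _ _ _; set K := _^-1.
transitivity (Gamma beta * a%:R * K * I *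
  (xi `^ (2 * a%:R * beta - 1) * (xi `^ (- (2 * a%:R * beta)) * xi))); first by ring.
by rewrite pw mulr1.
Qed.

Let moments_sum (c : nat -> R) (N : nat) : (N <= n.+1)%N ->
  mu.-integrable setT (EFin \o (fun u =>
    \sum_(0 <= k < N) c k * (u ^+ k * weight a beta u))) /\
  \int[mu]_u (\sum_(0 <= k < N) c k * (u ^+ k * weight a beta u)) =
  \sum_(0 <= k < N) c k * \int[mu]_u (u ^+ k * weight a beta u).
Proof.
elim: N => [_|N ih Nn].
  rewrite big_nil (_ : (fun u => _) = cst 0).
    by split; [exact: integrable0|rewrite Rintegral_cst// mul0r].
  by apply/funext => u; rewrite big_nil.
have [i1 e1] := ih (ltnW Nn).
have iN := integrable_expr_weight a N beta a0 (kb N Nn).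
have icN : mu.-integrable setT (EFin \o (fun u => c N * (u ^+ N * weight a beta u))).
  by rewrite (_ : _ \o _ = fun u => ((c N)%:E * (u ^+ N * weight a beta u)%:E)%E)//;
    exact: integrableZl.
rewrite (_ : (fun u => _) = fun u : R =>
  (\sum_(0 <= k < N) c k * (u ^+ k * weight a beta u)) + c N * (u ^+ N * weight a beta u)).
  split.
    rewrite (_ : _ \o _ = (fun u => (\sum_(0 <= k < N) c k * (u ^+ k * weight a beta u))%:E +
      (c N * (u ^+ N * weight a beta u))%:E)%E)//; exact: integrableD.
  by rewrite RintegralD// RintegralZl// e1 big_nat_recr.
by apply/funext => u; rewrite big_nat_recr.
Qed.

(** Only the remainder has to be assumed integrable. The Taylor terms up to order [n] are integrable
    because the weight has finite moments of these orders, and adding them makes the integrand of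
    the operator integrable, so the integral may be split. *)
Lemma Deltaf_integral (xi x : R) : 0 < xi ->
  mu.-integrable setT (EFin \o (fun u =>
     taylor_rem r n f x (xi * u) * weight a beta u)) ->
  Deltaf r n a beta xi f x =
  wconst * \int[mu]_u (taylor_rem r n f x (xi * u) * weight a beta u).
Proof.
move=> xi0 Hi.
(* The coefficient of order 0 is f(x) rather than f(x) times [deltak] at 0: the sum in [deltak]
   omits j = 0, and all the alpha_j together add up to 1. *)
pose c k := if k == 0%N then f x else
  derive1n k f x * deltak R r n k / k`!%:R * xi ^+ k.
have [Pi Pe] := moments_sum c n.+1 (leqnn _).
have NE (u : R) : (\sum_(0 <= j < r.+1) alphaj R r n j * f (x + j%:R * (xi * u)))
    * weight a beta u = taylor_rem r n f x (xi * u) * weight a beta u +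
   \sum_(0 <= k < n.+1) c k * (u ^+ k * weight a beta u).
  rewrite [in RHS]big_ltn//= /c/= expr0 mul1r.
  rewrite (_ : \sum_(1 <= k < n.+1) _ = (\sum_(1 <= k < n.+1)
    derive1n k f x * deltak R r n k / k`!%:R * (xi * u) ^+ k) * weight a beta u).
    rewrite /taylor_rem; ring.
  rewrite mulr_suml; apply: eq_big_nat => -[|k]// _ /=.
  by rewrite exprMn; ring.
have Ni : mu.-integrable setT (EFin \o (fun u =>
    (\sum_(0 <= j < r.+1) alphaj R r n j * f (x + j%:R * (xi * u))) * weight a beta u)).
  rewrite (_ : _ \o _ = (fun u => (taylor_rem r n f x (xi * u) * weight a beta u)%:E +
    (\sum_(0 <= k < n.+1) c k * (u ^+ k * weight a beta u))%:E)%E); last first.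
    by apply/funext => u; rewrite /= NE.
  exact: integrableD.
rewrite /Deltaf Mop_scale//; under eq_Rintegral do rewrite NE.
rewrite (RintegralD measurableT Hi Pi) Pe.
rewrite big_ltn// mulrDr mulrDr -/(wconst).
have -> : wconst * (c 0%N * \int[mu]_u (u ^+ 0 * weight a beta u)) = f x.
  rewrite (Rintegral_even_expr_weight a 0)// muln0 add0n /c /wconst/=.
  rewrite -[1%:R]/(1 : R); move: (Gamma (1 / (2 * a%:R))) (Gamma (beta - _))
    (Gamma beta) G1 G2 G3 => g1 g2 g3 g10 g20 g30.
  by field; rewrite (gt_eqF g10) (gt_eqF g20) (gt_eqF g30) (gt_eqF aR).
have -> : wconst * \sum_(1 <= k < n.+1) c k * \int[mu]_u (u ^+ k * weight a beta u) =
  \sum_(1 <= m < (n./2).+1) (derive1n (2 * m) f x * deltak R r n (2 * m) / (2 * m)`!%:R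
       * (Gamma ((2 * m + 1)%:R / (2 * a%:R))
          * Gamma (beta - (2 * m + 1)%:R / (2 * a%:R))
          / (Gamma (1 / (2 * a%:R)) * Gamma (beta - 1 / (2 * a%:R))))
       * xi ^+ (2 * m)).
  rewrite mulr_sumr big_even_nat; last first.
    by move=> k kn ok; rewrite Rintegral_odd_expr_weight ?mulr0//; exact: kb.
  apply: eq_big_nat => m /andP[m1 mn].
  have mn' : (2 * m <= n)%N by rewrite mul2n -geq_half_double -ltnS.
  rewrite Rintegral_even_expr_weight//; last by rewrite addn1; exact: kb.
  rewrite /c muln_eq0/= gtn_eqF// /wconst.
  have F0 : (2 * m)`!%:R != 0 :> R by rewrite pnatr_eq0 -lt0n fact_gt0.
  move: (Gamma (1 / (2 * a%:R))) (Gamma (beta - 1 / _)) (Gamma beta) G1 G2 G3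
    => g1 g2 g3 g10 g20 g30.
  move: (Gamma (_ / _)) (Gamma (beta - _)) (_`!%:R) F0 (derive1n _ _ _) (deltak _ _ _ _) => g4 g5 F F0 y z.
  by field; rewrite F0 (gt_eqF g10) (gt_eqF g20) (gt_eqF g30) (gt_eqF aR).
ring.
Qed.

End Delta_identity.

(** * Finiteness and positivity of tau *)

Section tau.
Context {R : realType}.
Local Notation mu := (@lebesgue_measure R).
Variables (r n a : nat) (p beta : R).
Hypotheses (a0 : (0 < a)%N) (n0 : (0 < n)%N) (p1 : 1 < p)
  (hbeta : a%:R^-1 * (p^-1 + n%:R + r%:R) < beta).

Let p0 : 0 < p. Proof. exact: lt_trans p1. Qed.
Let aR : 0 < a%:R :> R. Proof. by rewrite ltr0n. Qed.

Let tau1 (u : R) := (1 + u) `^ (r%:R * p + 1) * u `^ (n%:R * p - 1)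
  / (u ^+ (2 * a) + 1) `^ (p * beta / 2).
Let tau2 (u : R) := u `^ (n%:R * p - 1) / (u ^+ (2 * a) + 1) `^ (p * beta / 2).

Lemma beta_gt : p^-1 + n%:R + r%:R < a%:R * beta.
Proof. by rewrite mulrC -ltr_pdivrMr// mulrC. Qed.

Let measurable_tau2' e : measurable_fun setT
  (fun u : R => u `^ e / (u ^+ (2 * a) + 1) `^ (p * beta / 2)).
Proof.
apply: measurable_funM; first exact: measurable_powR.
exact: measurable_weight.
Qed.

Let measurable_tau1 : measurable_fun setT tau1.
Proof.
apply: measurable_funM; last exact: measurable_weight.
apply: measurable_funM; last exact: measurable_powR.
apply: (measurableT_comp (measurable_powR _)).
exact: measurable_funD.
Qed.

Let tau2_ge0 u : 0 <= tau2 u.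
Proof. by rewrite divr_ge0 ?powR_ge0. Qed.

Let tau1_ge0 u : 0 <= tau1 u.
Proof. by rewrite divr_ge0 ?mulr_ge0 ?powR_ge0. Qed.

Let power_weight_integrable s : 0 < s -> s < p * (a%:R * beta) ->
  mu.-integrable `]0%R, +oo[
   (EFin \o fun u : R => u `^ (s - 1) / (u ^+ (2 * a) + 1) `^ (p * beta / 2)).
Proof.
move=> s0 sb; apply/integrableP; split.
  by apply/measurable_EFinP; apply: measurable_funTS; exact: measurable_tau2'.
under eq_integral => u _ do rewrite /= ger0_norm ?divr_ge0 ?powR_ge0//.
rewrite beta_integral ?muln_gt0// ?ltry//.
rewrite natrM ltr_pdivrMr ?mulr_gt0//.
by rewrite (_ : p * beta / 2 * (2 * a%:R) = p * (a%:R * beta))//; field.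
Qed.

Lemma tau2_integrable : mu.-integrable `]0%R, +oo[ (EFin \o tau2).
Proof.
apply: power_weight_integrable; first by rewrite mulr_gt0// ltr0n.
rewrite mulrC ltr_pM2l// (le_lt_trans _ beta_gt)//.
by rewrite addrAC lerDr addr_ge0// invr_ge0 ltW.
Qed.

(** With e = rp+1, the inequality (1+u)^e <= 2^e (1+u^e) leaves two Beta integrals. The larger
    exponent np+rp+1 equals p(1/p+n+r), which is below p alpha beta precisely by the hypothesis on
    [beta]. *)
Lemma tau1_integrable : mu.-integrable `]0%R, +oo[ (EFin \o tau1).
Proof.
pose e := r%:R * p + 1.
have e0 : 0 < e by rewrite ltr_wpDl// mulr_ge0// ltW.
pose tau3 (u : R) := u `^ (n%:R * p + e - 1) / (u ^+ (2 * a) + 1) `^ (p * beta / 2).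
have i3 : mu.-integrable `]0%R, +oo[ (EFin \o tau3).
  apply: power_weight_integrable; first by rewrite addr_gt0// mulr_gt0// ltr0n.
  rewrite (_ : n%:R * p + e = p * (p^-1 + n%:R + r%:R)); last first.
    by rewrite /e; field; rewrite gt_eqF.
  by rewrite ltr_pM2l// beta_gt.
have i : mu.-integrable `]0%R, +oo[
    (fun u => (2 `^ e)%:E * ((tau2 u)%:E + (tau3 u)%:E))%E.
  apply: integrableZl => //.
  by apply: integrableD => //; exact: tau2_integrable.
apply: (le_integrable _ _ _ i) => //.
  by apply/measurable_EFinP; exact: measurable_funTS.
move=> u; rewrite /= in_itv/= andbT => u0.
rewrite lee_fin !ger0_norm ?tau1_ge0//; last first.
  by rewrite mulr_ge0 ?powR_ge0// addr_ge0 ?tau2_ge0// divr_ge0 ?powR_ge0.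
rewrite /tau1 /tau2 /tau3 -mulrDl mulrA.
rewrite ler_pM2r ?(weight_gt0 a (p * beta / 2) u)//.
have -> : u `^ (n%:R * p + e - 1) = u `^ (n%:R * p - 1) * u `^ e.
  rewrite -powRD; last by rewrite (gt_eqF u0) implybT.
  by congr (_ `^ _); ring.
rewrite -/e.
rewrite -[X in _ * (X + _)]mulr1 -mulrDr mulrCA mulrC ler_wpM2l ?powR_ge0//.
have [u1|u1] := leP u 1.
  rewrite (@le_trans _ _ (2 `^ e))//.
    by rewrite ge0_ler_powR ?nnegrE ?(ltW e0)//; lra.
  by rewrite ler_peMr ?powR_ge0// lerDl powR_ge0.
rewrite (@le_trans _ _ ((2 * u) `^ e))//.
  by rewrite ge0_ler_powR ?nnegrE ?(ltW e0)//; lra.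
by rewrite powRM ?(ltW u0)// ler_wpM2l ?powR_ge0// lerDr.
Qed.

Lemma tauE : tau r n a p beta =
  (\int[mu]_(u in `]0%R, +oo[) (tau1 u - tau2 u)%:E)%E.
Proof.
by rewrite /tau -integralB_EFin//; [exact: tau1_integrable|exact: tau2_integrable].
Qed.

Lemma tau_fin_num : tau r n a p beta \is a fin_num.
Proof.
by rewrite /tau fin_numB; apply/andP; split; apply: integrable_fin_num => //;
  [exact: tau1_integrable|exact: tau2_integrable].
Qed.

Lemma tau_gt0 : (0 < tau r n a p beta)%E.
Proof.
rewrite tauE; apply: integral_gt0 => //.
- by apply: measurable_funTS; exact: (measurable_funB measurable_tau1 (measurable_tau2' _)).
- rewrite [X in (_ < X)%E](lebesgue_measure_itv `]0%R, +oo[)/=.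
  by rewrite ltry addye// ltry.
- move=> u; rewrite /= in_itv/= andbT => u0.
  rewrite subr_gt0 /tau1 /tau2 ltr_pM2r ?(weight_gt0 a (p * beta / 2) u)//.
  rewrite ltr_pMl ?powR_gt0//.
  have e0 : 0 < r%:R * p + 1 by rewrite ltr_wpDl// mulr_ge0// ltW.
  suff : 1 `^ (r%:R * p + 1) < (1 + u) `^ (r%:R * p + 1) by rewrite powR1.
  by apply: gt0_ltr_powR; rewrite ?nnegrE//; lra.
Qed.

(** The form in which [tau] arises once s has been integrated out. The 2 from the two half-lines
    ends up in the factor (2 alpha)^(1/p) of the constant. *)
Lemma integral_tau_even :
  (\int[mu]_u ((((1 + `|u|) `^ (r%:R * p + 1) - 1) * `|u| `^ (n%:R * p - 1)
     * weight a (p * beta / 2) u)%:E) = 2%:E * tau r n a p beta)%E.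
Proof.
have e0 : 0 < r%:R * p + 1 by rewrite ltr_wpDl// mulr_ge0// ltW.
rewrite ge0_integral_even; last 3 first.
- apply/measurable_EFinP; apply: measurable_funM; last exact: measurable_weight.
  have mn : measurable_fun setT (fun u : R => `|u|) by exact: normr_measurable.
  apply: measurable_funM; last exact: (measurableT_comp (measurable_powR _) mn).
  apply: measurable_funB => //.
  by apply: (measurableT_comp (measurable_powR _)); exact: measurable_funD.
- move=> u; rewrite lee_fin !mulr_ge0 ?powR_ge0 ?(ltW (weight_gt0 _ _ _))//.
  rewrite subr_ge0.
  suff : 1 `^ (r%:R * p + 1) <= (1 + `|u|) `^ (r%:R * p + 1) by rewrite powR1.
  by apply: ge0_ler_powR; rewrite ?nnegrE ?(ltW e0) ?addr_ge0// lerDl.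
- by move=> u; rewrite normrN weightN.
rewrite tauE; congr (_ * _)%E; apply: eq_integral => u.
rewrite inE/= in_itv/= andbT => u0; congr EFin.
by rewrite gtr0_norm// /tau1 /tau2 /weight; ring.
Qed.

End tau.

(** * The Lp estimate *)

Section Lp_estimate.
Context {R : realType}.
Local Notation mu := (@lebesgue_measure R).
Variables (r n a : nat) (p q beta : R) (f : R -> R).
Hypotheses (r0 : (0 < r)%N) (a0 : (0 < a)%N)
  (p1 : 1 < p) (q1 : 1 < q) (pq : p^-1 + q^-1 = 1)
  (hbeta : a%:R^-1 * (p^-1 + n.+1%:R + r%:R) < beta)
  (Cf : Cn n.+1 f).

Let p0 : 0 < p. Proof. exact: lt_trans p1. Qed.
Let q0 : 0 < q. Proof. exact: lt_trans q1. Qed.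
Let aR : 0 < a%:R :> R. Proof. by rewrite ltr0n. Qed.

Let g := derive1n n.+1 f.

Let mg : measurable_fun setT g.
Proof. exact: (measurable_Cn_derive1n n.+1 f Cf n.+1 (leqnn _)). Qed.

(** Secures the finite moments of the weight up to order [n.+1], the order of differentiability of
    [f]. *)
Lemma moment_lt_beta : n.+2%:R / (2 * a%:R) < beta.
Proof.
have h := beta_gt r n.+1 a p beta a0 hbeta.
have pi : 0 < p^-1 by rewrite invr_gt0.
rewrite ltr_pdivrMr ?mulr_gt0//.
have r1 : 1 <= r%:R :> R by rewrite ler1n.
have nn : 0 <= n%:R :> R by [].
by move: h; rewrite -(natr1 n.+1) -(natr1 n); lra.
Qed.

Let nb := moment_lt_beta.

Lemma half_beta_gt : 1 / (2 * a%:R) < q * beta / 2.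
Proof.
have h := beta_gt r n.+1 a p beta a0 hbeta.
have pi : 0 < p^-1 by rewrite invr_gt0.
have r1 : 1 <= r%:R :> R by rewrite ler1n.
have nn : 0 <= n%:R :> R by [].
rewrite ltr_pdivrMr ?mulr_gt0// (_ : q * beta / 2 * (2 * a%:R) = q * (a%:R * beta)).
  rewrite (@lt_trans _ _ (a%:R * beta))//.
    by move: h; rewrite -(natr1 n); lra.
  by rewrite ltr_pMl//; move: h; rewrite -(natr1 n); lra.
by field.
Qed.

Let qb := half_beta_gt.

(** The q-th power of the L_q norm of [weight a (beta / 2)], the half of the weight that Hoelder's
    inequality separates from the remainder. *)
Definition weight_mass : R :=
  Gamma (1 / (2 * a%:R)) * Gamma (q * beta / 2 - 1 / (2 * a%:R))
     / (a%:R * Gamma (q * beta / 2)).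

Lemma integral_weight_mass : (\int[mu]_u (weight a (q * beta / 2) u)%:E = weight_mass%:E)%E.
Proof.
rewrite -(integral_normX_weight a 0)//.
by apply: eq_integral => u _; rewrite expr0 mul1r.
Qed.

Lemma weight_mass_gt0 : 0 < weight_mass.
Proof.
have g1 : 0 < 1 / (2 * a%:R) :> R by rewrite divr_gt0// mulr_gt0.
apply: divr_gt0; apply: mulr_gt0 => //; apply: Gamma_gt0 => //.
  by rewrite subr_gt0.
exact: lt_trans qb.
Qed.

(* If the right-hand side is infinite there is nothing to prove; otherwise the
   integral defining the operator at [x] converges absolutely. *)
Lemma Deltaf_pointwise (xi x : R) : 0 < xi ->
  ((`|Deltaf r n.+1 a beta xi f x| `^ p)%:E <=
   (wconst a beta `^ p * weight_mass `^ (p / q))%:E *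
   \int[mu]_u (`|taylor_rem r n.+1 f x (xi * u)| `^ p * weight a (p * beta / 2) u)%:E)%E.
Proof.
move=> xi0; set I := (\int[mu]_u _)%E.
have W0 := wconst_gt0 n.+1 a beta a0 nb.
have C0 : 0 < wconst a beta `^ p * weight_mass `^ (p / q).
  exact: mulr_gt0 (powR_gt0 _ W0) (powR_gt0 _ weight_mass_gt0).
have [->|Ioo] := eqVneq I +oo%E; first by rewrite gt0_muley ?lte_fin// leey.
pose F u := taylor_rem r n.+1 f x (xi * u) * weight a (beta / 2) u.
pose G := @weight R a (beta / 2).
have mrem : measurable_fun setT (fun u => taylor_rem r n.+1 f x (xi * u)).
  by apply: measurable_taylor_rem => //; exact: measurable_funM.
have mG : measurable_fun setT G by exact: measurable_weight.
have mF : measurable_fun setT F by exact: measurable_funM.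
have FG u : F u * G u = taylor_rem r n.+1 f x (xi * u) * weight a beta u.
  by rewrite /F /G -mulrA -weightD; congr (_ * weight a _ u); field.
have := hoelder_powR mu setT F G p q measurableT mF mG p0 q0 pq.
have -> : (\int[mu]_u (`|F u| `^ p)%:E = I)%E.
  apply: eq_integral => u _; congr EFin.
  rewrite /F normrM (ger0_norm (ltW (weight_gt0 _ _ _))) powRM//.
    by rewrite weight_powR; congr (_ * weight a _ u); field.
  exact/ltW/weight_gt0.
have -> : (\int[mu]_u (`|G u| `^ q)%:E = weight_mass%:E)%E.
  rewrite -integral_weight_mass; apply: eq_integral => u _; congr EFin.
  rewrite /G (ger0_norm (ltW (weight_gt0 _ _ _))) weight_powR.
  by congr (weight a _ u); field.
rewrite poweR_EFin => HI.
have I0 : (0 <= I)%E.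
  by apply: integral_ge0 => u _; rewrite lee_fin mulr_ge0 ?powR_ge0// ltW// weight_gt0.
have Ifin : I \is a fin_num by rewrite ge0_fin_numE// ltey.
have Jlt : (\int[mu]_u `|F u * G u|%:E < +oo)%E.
  apply: (@lty_poweRy _ _ p); first by rewrite gt_eqF.
  by apply: (le_lt_trans HI); rewrite -(fineK Ifin) -EFinM ltry.
have iFG : mu.-integrable setT (EFin \o (fun u =>
     taylor_rem r n.+1 f x (xi * u) * weight a beta u)).
  apply/integrableP; split.
    by apply/measurable_EFinP; apply: measurable_funM => //; exact: measurable_weight.
  by apply: le_lt_trans Jlt; under eq_integral do rewrite /= -FG.
rewrite (Deltaf_integral r n.+1 a beta f a0 nb Cf)// normrM powRM//.
rewrite (ger0_norm (ltW W0)) EFinM [X in (_ <= X * _)%E]EFinM -muleA.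
apply: lee_wpmul2l; first by rewrite lee_fin powR_ge0.
rewrite [leRHS]muleC; apply: le_trans HI.
rewrite -poweR_EFin; apply: gt0_ler_poweR; first exact: ltW.
- by rewrite in_itv/= leey andbT lee_fin.
- by rewrite in_itv/= leey andbT; apply: integral_ge0 => u _; rewrite lee_fin.
rewrite EFin_normr_Rintegral//.
apply: (le_trans (le_abse_integral _ _ _)) => //.
  by case/integrableP : iFG.
rewrite le_eqVlt; apply/orP; left; apply/eqP; apply: eq_integral => u _.
by rewrite FG.
Qed.

Lemma measurable_fdiff (d : measure_display) (T : measurableType d) (X Y : T -> R) :
  measurable_fun setT X -> measurable_fun setT Y ->
  measurable_fun setT (fun z => fdiff r (Y z) g (X z)).
Proof.
move=> mX mY; apply: measurable_sum => j; apply: measurable_funM => //.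
apply: (measurableT_comp mg); apply: measurable_funD => //.
exact: measurable_funM.
Qed.

(** The defining integral may diverge at some points. Measurability is therefore obtained from the
    positive and negative parts, each by Tonelli's theorem, followed by composition with [fine]. *)
Lemma measurable_Deltaf (xi : R) : measurable_fun setT (Deltaf r n.+1 a beta xi f).
Proof.
have mf : measurable_fun setT f by exact: (measurable_Cn_derive1n n.+1 f Cf 0).
apply: measurable_funB; first apply: measurable_funB => //.
  apply: measurable_funM => //.
  pose D (z : R * R) := ((\sum_(0 <= j < r.+1) alphaj R r n.+1 j * f (z.1 + j%:R * z.2))
    / (z.2 ^+ (2 * a) + xi ^+ (2 * a)) `^ beta)%:E.
  have mD : measurable_fun setT D.
    apply/measurable_EFinP; apply: measurable_funM.
      apply: measurable_sum => j; apply: measurable_funM => //.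
      apply: (measurableT_comp mf); apply: measurable_funD; first exact: measurable_fst.
      by apply: measurable_funM => //; exact: measurable_snd.
    apply: ge0_measurable_funV => [u|]; first exact: powR_ge0.
    apply: (measurableT_comp (measurable_powR beta)).
    by apply: measurable_funD => //; apply: measurable_funX; exact: measurable_snd.
  apply: (measurableT_comp (fine_measurable measurableT)).
  rewrite (_ : (fun x => _) = fun x => (fubini_F mu D^\+ x - fubini_F mu D^\- x)%E).
    apply: emeasurable_funB; apply: measurable_fun_fubini_tonelli_F => //.
      exact: measurable_funepos.
    exact: measurable_funeneg.
  apply/funext => x; rewrite integralE; congr (_ - _)%E;
    by apply: eq_integral => t _; rewrite ?funeposE ?funenegE.
under eq_fun do rewrite big_add1 big_mkord.
apply: measurable_sum => m; do 4 apply: measurable_funM => //.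
apply: (measurable_Cn_derive1n n.+1 f Cf).
by rewrite mul2n -geq_half_double.
Qed.

Definition rem_const : R := (n`!%:R `^ p * (q * n%:R + 1) `^ (p / q))^-1.

Lemma rem_const_ge0 : 0 <= rem_const.
Proof. by rewrite invr_ge0 mulr_ge0 ?powR_ge0. Qed.

(** Integrating in x before s turns the inner integral into the p-th power of the L_p norm of a
    difference with step ts, to which the modulus bound applies. *)
Lemma integral_taylor_rem_le (xi t : R) : 0 < xi ->
  (\int[mu]_x (`|taylor_rem r n.+1 f x t| `^ p)%:E <=
   (rem_const * `|t| `^ (n.+1%:R * p))%:E * (omega r p g xi `^ p *
     \int[mu]_(s in `[0%R, 1%R]) ((1 + `|t| / xi * s) `^ (r%:R * p))%:E))%E.
Proof.
move=> xi0; have c0 : (0 <= (rem_const * `|t| `^ (n.+1%:R * p))%:E)%E.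
  by rewrite lee_fin mulr_ge0 ?powR_ge0// rem_const_ge0.
pose D (z : R * R) := (`|fdiff r (t * z.2) g z.1| `^ p)%:E.
have mD : measurable_fun setT D.
  apply: measurable_normr_powR; apply: measurable_fdiff; first exact: measurable_fst.
  by apply: measurable_funM => //; exact: measurable_snd.
have D0 z : (0 <= D z)%E by rewrite lee_fin powR_ge0.
have mI : measurable_fun setT (fun x => \int[mu]_(s in `[0%R, 1%R]) D (x, s))%E.
  exact: measurable_fun_integralD.
apply: (@le_trans _ _ (\int[mu]_x ((rem_const * `|t| `^ (n.+1%:R * p))%:E *
    \int[mu]_(s in `[0%R, 1%R]) D (x, s)))%E).
  apply: ge0_le_integral => //.
  - by apply: measurable_normr_powR; exact: measurable_taylor_rem.
  - exact: measurable_funeM.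
  - by move=> x _; exact: taylor_rem_bound.
rewrite ge0_integralZl//; last by move=> x _; exact: integral_ge0.
apply: lee_wpmul2l => //.
rewrite (fubini_tonelliD mu mu setT `[0%R, 1%R]%classic D)//.
have om0 : (0 <= omega r p g xi)%E by apply: omega_ge0; exact: ltW.
rewrite -ge0_integralZl//=; last 3 first.
- apply/measurable_EFinP; apply: measurable_funTS.
  apply: (measurableT_comp (measurable_powR _)).
  by apply: measurable_funD => //; exact: measurable_funM.
- by move=> s _; rewrite lee_fin powR_ge0.
- exact: poweR_ge0.
apply: ge0_le_integral; first exact: measurable_itv.
- by move=> s _; apply: integral_ge0 => x _; exact: D0.
- apply: measurable_funTS.
  exact: (measurable_fun_fubini_tonelli_G (m1 := mu) D mD D0).
- apply: measurable_funTS; apply: measurable_funeM; apply/measurable_EFinP.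
  apply: (measurableT_comp (measurable_powR _)).
  by apply: measurable_funD => //; exact: measurable_funM.
- move=> s; rewrite /= in_itv/= => /andP[s0 s1].
  rewrite /D/= -normp_powR ?gt_eqF//.
  have base0 : 0 <= 1 + `|t| / xi * s.
    by rewrite addr_ge0// !mulr_ge0// invr_ge0 ltW.
  have H := normp_fdiff_omega p r (t * s) xi g (ltW p1) xi0 mg.
  apply: (@le_trans _ _ ((((1 + `|t * s| / xi) ^+ r)%:E * omega r p g xi) `^ p)%E).
    apply: gt0_ler_poweR H; first exact: ltW.
      by rewrite in_itv/= leey andbT normp_ge0.
    rewrite in_itv/= leey andbT mule_ge0// lee_fin exprn_ge0// addr_ge0//.
    by rewrite divr_ge0// ltW.
  rewrite normrM (ger0_norm s0) [`|t| * s / xi]mulrAC.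
  rewrite poweRM ?lee_fin ?exprn_ge0// poweR_EFin -powR_mulrn// -powRrM.
  by rewrite muleC.
Qed.

Lemma normp_Deltaf_powR (xi : R) : 0 < xi ->
  (normp p (Deltaf r n.+1 a beta xi f) `^ p <=
   (wconst a beta `^ p * weight_mass `^ (p / q) *
     (rem_const * xi `^ (n.+1%:R * p) / (r%:R * p + 1)) *
     (2 * fine (tau r n.+1 a p beta)))%:E * omega r p g xi `^ p)%E.
Proof.
move=> xi0; rewrite normp_powR ?gt_eqF//.
set C := wconst a beta `^ p * _.
have C0 : 0 <= C by rewrite mulr_ge0 ?powR_ge0.
have e0 : 0 < r%:R * p + 1 by rewrite ltr_wpDl// mulr_ge0// ltW.
pose D (z : R * R) := (`|taylor_rem r n.+1 f z.1 (xi * z.2)| `^ p *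
  weight a (p * beta / 2) z.2)%:E.
have mD : measurable_fun setT D.
  apply/measurable_EFinP; apply: measurable_funM; last first.
    by apply: (measurableT_comp (measurable_weight _ _)); exact: measurable_snd.
  apply/measurable_EFinP; apply: measurable_normr_powR.
  apply: (measurable_taylor_rem r n.+1 f Cf _ _ fst (fun z => xi * z.2)).
    exact: measurable_fst.
  by apply: measurable_funM => //; exact: measurable_snd.
have D0 z : (0 <= D z)%E.
  by rewrite lee_fin mulr_ge0 ?powR_ge0// ltW// weight_gt0.
have mI : measurable_fun setT (fun x => \int[mu]_u D (x, u))%E.
  exact: (measurable_fun_fubini_tonelli_F (m2 := mu) D mD D0).
apply: (@le_trans _ _ (\int[mu]_x (C%:E * \int[mu]_u D (x, u)))%E).
  apply: ge0_le_integral.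
  - exact: measurableT.
  - by move=> x _; rewrite lee_fin powR_ge0.
  - by apply: measurable_normr_powR; exact: measurable_Deltaf.
  - exact: measurable_funeM.
  - by move=> x _; exact: Deltaf_pointwise.
rewrite ge0_integralZl//; last by move=> x _; exact: integral_ge0.
clearbody C; rewrite -[C * _ * _]mulrA EFinM -muleA; apply: lee_wpmul2l; first by rewrite lee_fin.
have -> : (\int[mu]_x \int[mu]_u D (x, u) = \int[mu]_u \int[mu]_x D (x, u))%E.
  exact: (fubini_tonelli (m1 := mu) (m2 := mu) D mD D0).
set K := rem_const * _ / _; set Om := (omega r p g xi `^ p)%E.
have K0 : 0 <= K by rewrite !mulr_ge0 ?rem_const_ge0 ?powR_ge0 ?invr_ge0// ltW.
have Om0 : (0 <= Om)%E by exact: poweR_ge0.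
have KOm0 : (0 <= K%:E * Om)%E by rewrite mule_ge0// lee_fin.
have -> : ((K * (2 * fine (tau r n.+1 a p beta)))%:E * Om =
    (K%:E * Om) * (2%:E * tau r n.+1 a p beta))%E.
  rewrite -[in RHS](fineK (tau_fin_num r n.+1 a p beta a0 isT p1 hbeta)).
  by rewrite -muleA -[(2%:E * _)%E]EFinM [(Om * _)%E]muleC muleA -EFinM.
rewrite -(integral_tau_even r n.+1 a p beta a0 isT p1 hbeta).
pose phi (u : R) := ((1 + `|u|) `^ (r%:R * p + 1) - 1) * `|u| `^ (n.+1%:R * p - 1) *
  weight a (p * beta / 2) u.
have phi0 u : 0 <= phi u.
  rewrite !mulr_ge0 ?powR_ge0 ?(ltW (weight_gt0 _ _ _))//.
  rewrite subr_ge0.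
  suff : 1 `^ (r%:R * p + 1) <= (1 + `|u|) `^ (r%:R * p + 1) by rewrite powR1.
  by apply: ge0_ler_powR; rewrite ?nnegrE ?(ltW e0) ?addr_ge0// lerDl.
have mphi : measurable_fun setT (EFin \o phi).
  apply/measurable_EFinP; apply: measurable_funM; last exact: measurable_weight.
  have mn : measurable_fun setT (fun u : R => `|u|) by exact: normr_measurable.
  apply: measurable_funM; last exact: (measurableT_comp (measurable_powR _) mn).
  apply: measurable_funB => //.
  by apply: (measurableT_comp (measurable_powR _)); exact: measurable_funD.
apply: (@le_trans _ _ (\int[mu]_u (K%:E * Om * (phi u)%:E))%E); last first.
  by rewrite ge0_integralZl// => u _; rewrite lee_fin phi0.
apply: ge0_le_integral.
- exact: measurableT.
- by move=> u _; apply: integral_ge0 => x _; exact: D0.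
- exact: (measurable_fun_fubini_tonelli_G (m1 := mu) D mD D0).
- exact: measurable_funeM.
move=> u _; rewrite /D/=; under eq_integral do rewrite EFinM.
have w0 := weight_gt0 a (p * beta / 2) u.
rewrite ge0_integralZr//; last 2 first.
- by apply: measurable_normr_powR; exact: measurable_taylor_rem.
- by rewrite lee_fin ltW.
apply: (@le_trans _ _ ((rem_const * `|xi * u| `^ (n.+1%:R * p))%:E * (Om *
     \int[mu]_(s in `[0%R, 1%R]) ((1 + `|xi * u| / xi * s) `^ (r%:R * p))%:E) *
     (weight a (p * beta / 2) u)%:E)%E).
  apply: lee_wpmul2r; first by rewrite lee_fin ltW.
  exact: integral_taylor_rem_le.
have np0 : 0 < n.+1%:R * p by rewrite mulr_gt0.
(* The closed formula for the integral over s divides by |u|. At u = 0 the left side vanishes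
   because the power of |xi u| has a positive exponent. *)
have [->|u0] := eqVneq u 0.
  rewrite mulr0 normr0 powR0 ?gt_eqF// mulr0 mul0e mul0e.
  by rewrite mule_ge0// lee_fin.
have nu0 : 0 < `|u| by rewrite normr_gt0.
have -> : `|xi * u| / xi = `|u|.
  by rewrite normrM (gtr0_norm xi0) mulrC mulKf// gt_eqF.
rewrite integral_1Dmul_powR01// ?mulr_ge0// ?(ltW p0)//.
have E1 (x y w : R) : (x%:E * (Om * y%:E) * w%:E = (x * y * w)%:E * Om)%E.
  rewrite [(Om * y%:E)%E]muleC muleA -EFinM -muleA [(Om * w%:E)%E]muleC.
  by rewrite muleA -EFinM.
rewrite E1 -muleA [(Om * _)%E]muleC muleA -EFinM.
rewrite le_eqVlt; apply/orP; left; apply/eqP; congr (_%:E * _)%E.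
rewrite /K /phi normrM (gtr0_norm xi0) powRM ?(ltW xi0)//.
rewrite -(mulr_powRB1 (ltW nu0) np0); field.
by rewrite (gt_eqF nu0) (gt_eqF e0).
Qed.

End Lp_estimate.

(** * Algebraic form of the constant *)

Section constant.
Context {R : realType}.

(* Both sides are exponentials of affine forms in the logarithms. *)
Lemma Kconst_identity (p q A G1 G2 G3 G4 G5 F Q S X T : R) (N : nat) :
  0 < p -> p^-1 + q^-1 = 1 -> 0 < A -> 0 < G1 -> 0 < G2 -> 0 < G3 ->
  0 < G4 -> 0 < G5 -> 0 < F -> 0 < Q -> 0 < S -> 0 < X -> 0 < T ->
  (G3 * A / (G1 * G2)) `^ p * (G1 * G4 / (A * G5)) `^ (p / q) *
  ((F `^ p * Q `^ (p / q))^-1 * X `^ (N%:R * p) / S) * (2 * T) =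
  ((2 * A) `^ (1 / p) * G3 * G4 `^ (1 / q) * X ^+ N * T `^ (1 / p) /
   (G5 `^ (1 / q) * G1 `^ (1 / p) * G2 * S `^ (1 / p) * F * Q `^ (1 / q))) `^ p.
Proof.
move=> p0 pq /expR_total[lA <-] /expR_total[l1 <-] /expR_total[l2 <-].
move=> /expR_total[l3 <-] /expR_total[l4 <-] /expR_total[l5 <-].
move=> /expR_total[lF <-] /expR_total[lQ <-] /expR_total[lS <-].
move=> /expR_total[lX <-] /expR_total[lT <-].
have [l e2] := expR_total (ltr0n R 2); rewrite -e2.
rewrite -expRM_natl -!expRN -!expRD -!expRM -!expRD -!expRN -!expRD -!expRM -!expRD.
congr expR.
have qE : q^-1 = 1 - p^-1 by rewrite -pq addrC addKr.
by rewrite !div1r qE; field; rewrite gt_eqF.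
Qed.

End constant.

(** * The norm bound and the limits as xi tends to 0 *)

Section conclusion.
Context {R : realType}.
Local Notation mu := (@lebesgue_measure R).
Variables (r n a : nat) (p q beta : R) (f : R -> R).
Hypotheses (r0 : (0 < r)%N) (a0 : (0 < a)%N)
  (p1 : 1 < p) (q1 : 1 < q) (pq : p^-1 + q^-1 = 1)
  (hbeta : a%:R^-1 * (p^-1 + n.+1%:R + r%:R) < beta)
  (Cf : Cn n.+1 f).

Let p0 : 0 < p. Proof. exact: lt_trans p1. Qed.
Let q0 : 0 < q. Proof. exact: lt_trans q1. Qed.
Let aR : 0 < a%:R :> R. Proof. by rewrite ltr0n. Qed.
Let tau0 : 0 < fine (tau r n.+1 a p beta).
Proof.
rewrite -lte_fin fineK; last exact: tau_fin_num.
exact: tau_gt0.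
Qed.

Lemma Kconst_powR (xi : R) : 0 < xi ->
  wconst a beta `^ p * weight_mass a q beta `^ (p / q) *
   (rem_const n p q * xi `^ (n.+1%:R * p) / (r%:R * p + 1)) *
   (2 * fine (tau r n.+1 a p beta)) = Kconst r n.+1 a p q beta xi `^ p.
Proof.
move=> xi0.
have e0 : 0 < r%:R * p + 1 by rewrite ltr_wpDl// mulr_ge0// ltW.
have Q0 : 0 < q * n%:R + 1 by rewrite ltr_wpDl// mulr_ge0// ltW.
have F0 : 0 < n`!%:R :> R by rewrite ltr0n fact_gt0.
have nb := moment_lt_beta r n a p beta r0 a0 p1 hbeta.
have g1 : 0 < 1 / (2 * a%:R) :> R by rewrite divr_gt0// mulr_gt0.
have b1 : 1 / (2 * a%:R) < beta.
  apply: le_lt_trans nb; rewrite ler_pM2r ?invr_gt0 ?mulr_gt0//.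
  by rewrite ler1n.
have qb := half_beta_gt r n a p q beta r0 a0 p1 q1 hbeta.
have G1 := Gamma_gt0 _ g1.
have G2 : 0 < Gamma (beta - 1 / (2 * a%:R)) by apply: Gamma_gt0; rewrite subr_gt0.
have G3 : 0 < Gamma beta by exact: Gamma_gt0 (lt_trans g1 b1).
have G4 : 0 < Gamma (q * beta / 2 - 1 / (2 * a%:R)).
  by apply: Gamma_gt0; rewrite subr_gt0.
have G5 : 0 < Gamma (q * beta / 2) by exact: Gamma_gt0 (lt_trans g1 qb).
exact: Kconst_identity.
Qed.

Lemma Kconst_ge0 (xi : R) : 0 < xi -> 0 <= Kconst r n.+1 a p q beta xi.
Proof.
move=> xi0; have nb := moment_lt_beta r n a p beta r0 a0 p1 hbeta.
have g1 : 0 < 1 / (2 * a%:R) :> R by rewrite divr_gt0// mulr_gt0.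
have b1 : 1 / (2 * a%:R) < beta.
  apply: le_lt_trans nb; rewrite ler_pM2r ?invr_gt0 ?mulr_gt0//.
  by rewrite ler1n.
have G2 : 0 <= Gamma (beta - 1 / (2 * a%:R)) by rewrite ltW// Gamma_gt0// subr_gt0.
have G3 : 0 <= Gamma beta by rewrite ltW// Gamma_gt0// (lt_trans g1).
by rewrite divr_ge0 ?mulr_ge0 ?powR_ge0 ?exprn_ge0// ltW.
Qed.

Lemma normp_Deltaf_le (xi : R) : 0 < xi ->
  (normp p (Deltaf r n.+1 a beta xi f) <=
   (Kconst r n.+1 a p q beta xi)%:E * omega r p (derive1n n.+1 f) xi)%E.
Proof.
move=> xi0; have := normp_Deltaf_powR r n a p q beta f r0 a0 p1 q1 pq hbeta Cf xi xi0.
rewrite Kconst_powR// -poweR_EFin.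
have K0 := Kconst_ge0 xi xi0.
have om0 : (0 <= omega r p (derive1n n.+1 f) xi)%E by apply: omega_ge0; exact: ltW.
rewrite -poweRM ?lee_fin// => H.
have root (y : \bar R) : (0 <= y)%E -> ((y `^ p) `^ p^-1)%E = y.
  by move=> y0; rewrite -poweRrM mulfV ?gt_eqF// poweRe1.
rewrite -(root _ (normp_ge0 _ _)) -(root (_ * _)%E); last by rewrite mule_ge0 ?lee_fin.
apply: gt0_ler_poweR H; first by rewrite invr_ge0 ltW.
  by rewrite in_itv/= leey andbT poweR_ge0.
by rewrite in_itv/= leey andbT poweR_ge0.
Qed.

(** The bounding polynomial has no constant term, since its sum starts at index 1. Both limits are
    of this kind: one bound is a single power of [xi], the other also contains even powers from the
    Taylor terms. *)
Lemma cvg_at_right_polynomial_bound (F : R -> \bar R) (N : nat) (c : nat -> R) :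
  (forall xi, 0 < xi -> (0 <= F xi)%E) ->
  (forall xi, 0 < xi -> (F xi <= (\sum_(1 <= i < N) c i * xi ^+ i)%:E)%E) ->
  F xi @[xi --> 0^'+] --> 0%E.
Proof.
move=> F0 FN; pose h (xi : R) := \sum_(1 <= i < N) c i * xi ^+ i.
have ch : continuous h.
  apply: (continuous_bigsum _ _ (fun i xi => c i * xi ^+ i)) => i.
  by apply: continuous_cstM; exact: exprn_continuous.
have h0 : h 0 = 0.
  by apply: big1_seq => i /=; rewrite mem_index_iota => /andP[i1 _];
    rewrite expr0n gtn_eqF// mulr0.
apply: (@squeeze_cvge _ _ _ _ (cst 0%E) _ (EFin \o h)).
- near=> xi; have xi0 : 0 < xi by near: xi; exact: nbhs_right_gt.
  by rewrite F0//= FN.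
- exact: cvg_cst.
- apply/fine_cvgP; split; first exact: nearW.
  by have := cvg_at_right_filter (ch 0); rewrite h0.
Unshelve. all: by end_near. Qed.

Lemma Kconst_Xn (xi : R) :
  Kconst r n.+1 a p q beta xi = Kconst r n.+1 a p q beta 1 * xi ^+ n.+1.
Proof. by rewrite /Kconst expr1n; ring. Qed.

Hypothesis Lf : in_Lp p (derive1n n.+1 f).

Lemma normp_Deltaf_bounded : exists M : R, forall xi, 0 < xi ->
  (normp p (Deltaf r n.+1 a beta xi f) <= (M * xi ^+ n.+1)%:E)%E.
Proof.
have [M M0 HM] := omega_bounded p r _ (ltW p1) Lf.
exists (Kconst r n.+1 a p q beta 1 * M) => xi xi0.
apply: (le_trans (normp_Deltaf_le xi xi0)).
rewrite mulrAC -Kconst_Xn [X in (_ <= X)%E]EFinM; apply: lee_wpmul2l; last exact: HM.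
by rewrite lee_fin Kconst_ge0.
Qed.

Lemma cvg_normp_Deltaf : normp p (Deltaf r n.+1 a beta xi f) @[xi --> 0^'+] --> 0%E.
Proof.
have [M HM] := normp_Deltaf_bounded.
apply: (cvg_at_right_polynomial_bound _ n.+2 (fun i => M *+ (i == n.+1))) => xi xi0.
  exact: normp_ge0.
apply: (le_trans (HM xi xi0)); rewrite lee_fin big_nat_recr//= eqxx mulr1n.
rewrite big1_seq ?add0r// => i; rewrite /= mem_index_iota => /andP[_ iN].
by rewrite ltn_eqF// mulr0n mul0r.
Qed.

(** M f - f is Delta plus the even Taylor terms. Each of these is a positive power of [xi] times a
    fixed L_p function, so the triangle inequality gives a polynomial bound. *)
Lemma cvg_normp_Mop_sub :
  (forall m, (1 <= m <= n.+1./2)%N -> in_Lp p (derive1n (2 * m) f)) ->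
  normp p (fun x => Mop r n.+1 a beta xi f x - f x) @[xi --> 0^'+] --> 0%E.
Proof.
move=> Lm; have [M HM] := normp_Deltaf_bounded.
pose d m : R := deltak R r n.+1 (2 * m) / (2 * m)`!%:R
       * (Gamma ((2 * m + 1)%:R / (2 * a%:R))
          * Gamma (beta - (2 * m + 1)%:R / (2 * a%:R))
          / (Gamma (1 / (2 * a%:R)) * Gamma (beta - 1 / (2 * a%:R)))).
(* The ordinal [i] stands for m = i+1, so the orders 2m start at 2. *)
pose u xi (i : 'I_(n.+1./2)) x := d i.+1 * xi ^+ (2 * i.+1) * derive1n (2 * i.+1) f x.
have im (i : 'I_(n.+1./2)) : (1 <= i.+1 <= n.+1./2)%N by rewrite ltn_ord.
have mi (i : 'I_(n.+1./2)) : measurable_fun setT (derive1n (2 * i.+1) f).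
  by have [] := Lm _ (im i).
pose Nm m := fine (normp p (derive1n (2 * m) f)).
(* The coefficient of xi^k collects the bound on Delta at k = n+1 and the norms of the Taylor terms
   at the even k; when n+1 is even, both contribute to the top coefficient. *)
pose c k : R := M *+ (k == n.+1) +
  \sum_(i < n.+1./2) (`|d i.+1| * Nm i.+1) *+ (k == 2 * i.+1)%N.
apply: (cvg_at_right_polynomial_bound _ n.+2 c) => xi xi0; first exact: normp_ge0.
rewrite (eq_normp _ _ (fun x => Deltaf r n.+1 a beta xi f x + \sum_(i < n.+1./2) u xi i x)).
  apply: (le_trans (ler_normpD _ _ _ (ltW p1) _ _)).
  - exact: measurable_Deltaf.
  - by apply: measurable_sum => i; exact: measurable_funM.
  have -> : \sum_(1 <= k < n.+2) c k * xi ^+ k = M * xi ^+ n.+1 +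
      \sum_(i < n.+1./2) `|d i.+1| * Nm i.+1 * xi ^+ (2 * i.+1).
    under eq_bigr do rewrite /c mulrDl mulr_suml.
    rewrite big_split/= exchange_big/=; congr (_ + _).
      rewrite big_nat_recr//= eqxx mulr1n big1_seq ?add0r// => i.
      by rewrite /= mem_index_iota => /andP[_ iN]; rewrite ltn_eqF// mulr0n mul0r.
    apply: eq_bigr => i _; rewrite (bigD1_seq (2 * i.+1)%N) ?iota_uniq//; last first.
      by rewrite mem_index_iota muln_gt0/= mul2n ltnS -geq_half_double ltn_ord.
    rewrite /= eqxx mulr1n big1 ?addr0// => k /negbTE ->.
    by rewrite mulr0n mul0r.
  rewrite EFinD; apply: leeD; first exact: HM.
  apply: (le_trans (ler_normp_sum _ _ _ _ (ltW p1) _)).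
    by move=> i; exact: measurable_funM.
  rewrite -sumEFin; apply: lee_sum => i _.
  have [_ fi] := Lm _ (im i).
  rewrite /u normpZ// normrM (ger0_norm (exprn_ge0 _ (ltW xi0))).
  rewrite /Nm mulrAC [X in (_ <= X)%E]EFinM fineK//.
  by rewrite ge0_fin_numE ?normp_ge0.
move=> x; rewrite /Deltaf big_add1 big_mkord -addrA [X in _ = _ + X](_ : _ = 0) ?addr0//.
rewrite addrC -sumrB; apply: big1 => i _; rewrite /u /d.
by set y := derive1n (2 * i.+1) f x; ring.
Qed.

End conclusion.

Theorem theorem1 (R : realType) (r n a : nat) (p q beta : R) (f : R -> R) :
  (1 <= r)%N -> (1 <= n)%N -> (1 <= a)%N ->
  1 < p -> 1 < q -> p^-1 + q^-1 = 1 ->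
  beta > a%:R^-1 * (p^-1 + n%:R + r%:R) ->
  Cn n f -> in_Lp p (derive1n n f) ->
  [/\ (0 < tau r n a p beta)%E /\ (tau r n a p beta < +oo)%E,
      (forall xi : R, 0 < xi ->
         (normp p (Deltaf r n a beta xi f)
          <= (Kconst r n a p q beta xi)%:E * omega r p (derive1n n f) xi)%E),
      (normp p (Deltaf r n a beta xi f) @[xi --> 0^'+] --> 0%E)
    & ((forall m, (1 <= m <= n./2)%N -> in_Lp p (derive1n (2 * m) f)) ->
       normp p (fun x => Mop r n a beta xi f x - f x) @[xi --> 0^'+] --> 0%E)].

case: n => [|n']; first by [].
move=> r0 _ a0 p1 q1 pq hbeta Cf Lf; split.
- split; first exact: tau_gt0.
  have := tau_fin_num r n'.+1 a p beta a0 isT p1 hbeta.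
  by rewrite ge0_fin_numE// ltW// tau_gt0.
- by move=> xi xi0; apply: normp_Deltaf_le.
- exact: (cvg_normp_Deltaf r n' a p q).
- exact: (cvg_normp_Mop_sub r n' a p q).
Qed.
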